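(* Let $(X,\mu)$ be a nonatomic probability space with a tree $\mathcal{T}$, let $q\in(0,1)$, and let $f,h,L$ be fixed real numbers with $0<h\le f^q$ and $L\ge f$ (where $f>0$). Let $(\phi_n)_{n\in\mathbb{N}}$ be a sequence of nonnegative measurable $\mathcal{T}$-good functions $\phi_n:X\to[0,\infty)$ such that $\int_X\phi_n\,d\mu=f$ and $\int_X\phi_n^q\,d\mu=h$ for every $n$. Then the following are equivalent: (i) $\displaystyle\lim_{n\to\infty}\int_X\left[\max(\mathcal{M}_{\mathcal{T}}\phi_n,L)\right]^q d\mu=B_q^{\mathcal{T}}(f,h,L,1)$; (ii) $\displaystyle\lim_{n\to\infty}\int_X\left|\max(\mathcal{M}_{\mathcal{T}}\phi_n,L)-c^{1/q}\phi_n\right|^q d\mu=0$, where $c=\omega_q\!\left(\dfrac{(1-q)L^q+qL^{q-1}f}{h}\right)$.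
   Context: A tree $\mathcal{T}$ on a nonatomic probability space $(X,\mu)$ is a family of measurable subsets of $X$ such that: (1) $X\in\mathcal{T}$ and $\mu(I)>0$ for all $I\in\mathcal{T}$; (2) for every $I\in\mathcal{T}$ there is a finite or countable subset $C(I)\subseteq\mathcal{T}$ with at least two elements, whose elements are pairwise disjoint subsets of $I$ with $I=\bigcup C(I)$; (3) $\mathcal{T}=\bigcup_{m\ge0}\mathcal{T}_{(m)}$, where $\mathcal{T}_{(0)}=\{X\}$ and $\mathcal{T}_{(m+1)}=\bigcup_{I\in\mathcal{T}_{(m)}}C(I)$; (4) $\lim_{m\to\infty}\sup_{I\in\mathcal{T}_{(m)}}\mu(I)=0$. For $\phi\in L^1(X,\mu)$ the dyadic maximal operator is $\mathcal{M}_{\mathcal{T}}\phi(x)=\sup\left\{\frac{1}{\mu(I)}\int_I|\phi|\,d\mu: x\in I\in\mathcal{T}\right\}$. For nonnegative $\phi\in L^1(X,\mu)$ and $I\in\mathcal{T}$, $\mathrm{Av}_I(\phi)=\frac{1}{\mu(I)}\int_I\phi\,d\mu$. A nonnegative $\phi\in L^1(X,\mu)$ is $\mathcal{T}$-good if the set $\{x\in X:\mathcal{M}_{\mathcal{T}}\phi(x)>\mathrm{Av}_I(\phi)\text{ for all }I\in\mathcal{T}\text{ with }x\in I\}$ has $\mu$-measure zero. The Bellman function is $B_q^{\mathcal{T}}(f,h,L,1)=\sup\left\{\int_X[\max(\mathcal{M}_{\mathcal{T}}\phi,L)]^q d\mu:\ \phi\ge0\text{ measurable},\ \int_X\phi\,d\mu=f,\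 \int_X\phi^q\,d\mu=h\right\}$. The function $\omega_q:[1,\infty)\to[1,\infty)$ is $\omega_q(z)=[H_q^{-1}(z)]^q$, where $H_q^{-1}$ is the inverse of $H_q:[1,\infty)\to[1,\infty)$, $H_q(z)=(1-q)z^q+qz^{q-1}$. *)

(* Defs.v *)
From HB Require Import structures.
From mathcomp Require Export all_boot all_order all_algebra.
From mathcomp Require Export all_classical all_reals all_analysis.

Set Implicit Arguments.
Unset Strict Implicit.
Unset Printing Implicit Defensive.

Export Order.TTheory GRing.Theory Num.Theory.
Export numFieldNormedType.Exports.

Local Open Scope classical_set_scope.
Local Open Scope ring_scope.
Local Open Scope ereal_scope.

Section Tree.
Context {d : measure_display} {X : measurableType d} {R : realType}.
Variable mu : probability X R.

Definition nonatomic : Prop :=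
  forall A : set X, measurable A -> 0 < mu A ->
    exists B : set X, [/\ measurable B, B `<=` A, 0 < mu B & mu B < mu A].

Fixpoint tree_level (C : set X -> set (set X)) (m : nat) : set (set X) :=
  if m is m'.+1 then \bigcup_(I in tree_level C m') C I else [set setT].

(* [C I] is the set of children of I; it is constrained only for I in T. *)
Record is_tree_with (C : set X -> set (set X)) (T : set (set X)) : Prop := {
  tree_measurable : forall I, T I -> measurable I ;
  tree_root : T setT ;
  tree_pos : forall I, T I -> 0 < mu I ;
  tree_child : forall I, T I -> C I `<=` T ;
  tree_countable : forall I, T I -> countable (C I) ;
  tree_split : forall I, T I -> exists J K, [/\ C I J, C I K & J <> K] ;
  tree_disjoint : forall I, T I -> trivIset (C I) id ;
  tree_cover : forall I, T I -> I = \bigcup_(J in C I) J ;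
  tree_levels : T = \bigcup_m tree_level C m ;
  tree_mesh :
    ereal_sup [set mu I | I in tree_level C m] @[m --> \oo] --> 0 }.

Definition is_tree (T : set (set X)) : Prop := exists C, is_tree_with C T.

Definition Av (I : set X) (phi : X -> R) : \bar R :=
  (\int[mu]_(x in I) (phi x)%:E) / mu I.

(* Extended-valued: the supremum may be +oo (on a null set when phi is
   integrable). *)
Definition maximal (T : set (set X)) (phi : X -> R) (x : X) : \bar R :=
  ereal_sup [set Av I (fun y => `|phi y|%R) | I in [set I | T I /\ I x]].

Definition good (T : set (set X)) (phi : X -> R) : Prop :=
  [/\ forall x, (0 <= phi x)%R,
      mu.-integrable setT (EFin \o phi) &
      mu.-negligible
        [set x | forall I, T I -> I x -> Av I phi < maximal T phi x]].

Definition bellman (T : set (set X)) (q f h L : R) : \bar R :=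
  ereal_sup
    [set \int[mu]_x (maxe (maximal T phi x) L%:E `^ q) | phi in
      [set phi : X -> R |
        [/\ forall x, (0 <= phi x)%R, measurable_fun setT phi,
            \int[mu]_x (phi x)%:E = f%:E &
            \int[mu]_x (phi x `^ q)%:E = h%:E]]].

End Tree.

Section Omega.
Context {R : realType}.
Local Open Scope ring_scope.

Definition Hq (q z : R) : R := (1 - q) * z `^ q + q * z `^ (q - 1).

(* [Hq q] is a bijection of [1, +oo[ for 0 < q < 1; the default value 1 of the
   partial inverse is only taken outside [1, +oo[. *)
Definition omega (q z : R) : R :=
  ('pinv_(fun=> 1) `[1, +oo[ (Hq q) z) `^ q.

End Omega.

(* Main.v *)
Require Import Defs.
From mathcomp Require Import measurable_realfun ring lra.

(** Write [M] for the maximum of [L] and the maximal function of [phi], put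
    [A := (1 - q) L^q + q L^(q-1) f], and let [b >= 1] solve [Hq q b = A / h],
    so that the constant of the theorem is [c = b^q].  Everything rests on
    Young's inequality in the form
      [a^q <= q a M^(q-1) + (1 - q) M^q],
    with equality only at [a = M]; the difference of the two sides is
    [young_gap].

    Upper bound and stability ([maximal_stability]).  The function [M] is the
    limit of the running maxima of the averages of [phi] over the cubes of
    level 0, 1, 2, and so on.  Young's inequality, applied at each step where
    the running maximum jumps, shows that the integral of
    [(1 - q) M^q + q phi M^(q-1)] does not increase along these levels, hence
    is at most its initial value [A] ([kolmogorov_inequality]).  Combined with
    [A = h Hq q b], this bounds the integral of the gap between [M] and
    [b phi] by [(1 - q) (b - 1) (b^q h - I)], where [I] is the integral of
    [M^q].  As the gap is nonnegative, this gives [I <= b^q h] when [b > 1]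
    (the proof uses a variant that covers [b = 1] too).  As the gap moreover
    controls [|M - b phi|^q] up to a small multiple of [M^q]
    ([dist_powR_le_gap]), a sequence for which [I] tends to [b^q h] satisfies
    (ii).  Conversely [b^q h <= I + D] with [D] the integral of
    [|M - b phi|^q], by subadditivity of the power, so (ii) forces [I] to tend
    to [b^q h].

    Value of the Bellman function ([bellman_value]).  It remains to see that
    the supremum is exactly [b^q h], that is, to find admissible functions with
    [M >= b' phi] everywhere for [b'] as close to [b] as wanted.  Since the
    measures of the cubes tend to 0, every mass is the mass of a disjoint union
    of cubes inside a given cube ([tree_family_of_mass]); iterating this gives
    nested unions of cubes whose masses decrease geometrically, inside every
    chosen cube as well ([nested_families]).  A function that grows
    geometrically along these layers has on every chosen cube an average equal
    to [b'] times its value on the outermost layer of that cube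
    ([extremal_function]).  The integral of its power of exponent [q] is
    explicit, close to [A / Hq q b'], and is tuned to be exactly [h] by the
    intermediate value theorem ([profile_power_tuning]). *)

Set Implicit Arguments.
Unset Strict Implicit.
Unset Printing Implicit Defensive.

Local Open Scope classical_set_scope.
Local Open Scope ring_scope.
Local Open Scope ereal_scope.

(** * Young's inequality for powers and its gap *)

Section PowerInequalities.
Local Open Scope ring_scope.
Context {R : realType}.
Implicit Types q t u a M z : R.

Lemma powR_subr1 q M : 0 < M -> M `^ (q - 1) = M `^ q / M.
Proof.
by move=> M0; rewrite powRB ?(lt0r_neq0 M0) ?implybT// powRr1// ltW.
Qed.

Lemma powR_div q a M : 0 <= a -> 0 < M -> (a / M) `^ q = a `^ q / M `^ q.
Proof.
move=> a0 M0; have Mq : 0 < M `^ q by rewrite powR_gt0.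
apply: (mulIf (lt0r_neq0 Mq)); rewrite divfK ?lt0r_neq0//.
by rewrite -powRM ?divr_ge0 ?(ltW M0)// divfK ?lt0r_neq0.
Qed.

Lemma powR_exprn q a n : 0 <= a -> (a ^+ n) `^ q = (a `^ q) ^+ n.
Proof.
by move=> a0; rewrite -(powR_mulrn n a0) -(powR_mulrn n (powR_ge0 a q)) powRAC.
Qed.

Lemma powR_le_tangent q u : 0 < q < 1 -> 0 <= u -> u `^ q <= 1 - q + q * u.
Proof.
move=> /andP[q0 q1] u0.
have q1' : 0 < 1 - q by rewrite subr_gt0.
have := @conjugate_powR R (u `^ q) 1 q^-1 (1 - q)^-1 (powR_ge0 _ _) ler01.
rewrite !invr_gt0 !invrK => /(_ q0 q1').
rewrite subrKC => /(_ erefl); rewrite mulr1 powR1 -powRrM divff ?gt_eqF//.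
rewrite powRr1//; lra.
Qed.

(** Squaring the tangent bound at the square root of [u] gains a square: this
    quantifies the strictness of [powR_le_tangent] with no calculus. *)
Lemma tangent_gap_ge q u : 0 < q < 1 -> 0 <= u ->
  q * (1 - q) * (Num.sqrt u - 1) ^+ 2 <= 1 - q + q * u - u `^ q.
Proof.
move=> q01 u0; set s := Num.sqrt u.
have s0 : 0 <= s by exact: sqrtr_ge0.
have us : u = s ^+ 2 by rewrite sqr_sqrtr.
have h := powR_le_tangent q01 s0.
have : u `^ q <= (1 - q + q * s) ^+ 2.
  by rewrite us expr2 powRM// -expr2 lerXn2r ?nnegrE ?powR_ge0//; nra.
by rewrite us; nra.
Qed.

(** The tangent bound at [a / M], made homogeneous. *)
Lemma young_powR q a M : 0 < q < 1 -> 0 <= a -> 0 < M ->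
  a `^ q <= q * (a * M `^ (q - 1)) + (1 - q) * M `^ q.
Proof.
move=> q01 a0 M0; have := powR_le_tangent q01 (divr_ge0 a0 (ltW M0)).
have Mq : 0 < M `^ q by rewrite powR_gt0.
rewrite -(ler_pM2r Mq) -powRM ?divr_ge0 ?(ltW M0)//.
rewrite divfK ?gt_eqF// => /le_trans; apply.
rewrite powR_subr1//.
by rewrite le_eqVlt; apply/orP; left; apply/eqP; field; exact: lt0r_neq0.
Qed.

(** The deficit in [young_powR]. *)
Definition young_gap q M a := q * (a * M `^ (q - 1)) + (1 - q) * M `^ q - a `^ q.

(** After scaling to [M = 1] and with [s] the square root of [a], the gap is at
    least a multiple of [(s - 1)^2], while [|s^2 - 1| <= (s - 1)^2 + 2 |s - 1|].
    The linear term is not controlled by the gap; the parameter [t] trades it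
    for a small constant, and [young_powR] at the point [t] passes to the power
    of exponent [q]. *)
Lemma dist_powR_le_gap q t a M : 0 < q < 1 -> 0 < t -> 0 <= a -> 0 < M ->
  `|M - a| `^ q <= t `^ q * M `^ q +
    t `^ (q - 1) * (1 + t^-1) / (1 - q) * young_gap q M a.
Proof.
move=> q01 t0 a0 M0; have /andP[q0 q1] := q01.
have Mq : 0 < M `^ q by rewrite powR_gt0.
pose u := a / M; have u0 : 0 <= u by rewrite divr_ge0 ?(ltW M0).
have aE : a = M * u by rewrite /u mulrC divfK ?gt_eqF.
have -> : `|M - a| = M * `|u - 1|.
  by rewrite distrC aE -{2}[M]mulr1 -mulrBr normrM gtr0_norm.
have -> : young_gap q M a = M `^ q * (1 - q + q * u - u `^ q).
  rewrite /young_gap aE powRM ?(ltW M0)// powR_subr1//.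
  field; exact: lt0r_neq0.
rewrite powRM ?(ltW M0)// mulrCA [t `^ q * _]mulrC -mulrDr.
apply: ler_wpM2l; first exact: ltW.
set y := `|u - 1|; set s := Num.sqrt u.
have s0 : 0 <= s by exact: sqrtr_ge0.
have us : u = s ^+ 2 by rewrite sqr_sqrtr.
have y0 : 0 <= y by exact: normr_ge0.
have ti : t * t^-1 = 1 by rewrite divff ?gt_eqF.
have ti0 : 0 < t^-1 by rewrite invr_gt0.
(* [2 |s - 1| <= t + (s - 1)^2 / t] *)
have hy : y <= t + (1 + t^-1) * (s - 1) ^+ 2.
  have e : t + (1 + t^-1) * (s - 1) ^+ 2 - (s - 1)^+2 =
    t^-1 * (t ^+ 2 + (s - 1)^+2).
    rewrite expr2; field; exact: lt0r_neq0.
  have h1 : t^-1 * (t ^+ 2 + (s - 1)^+2) >= 2 * (s - 1).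
    have -> : 2 * (s-1) = t^-1 * (2 * (t * (s-1))).
      by field; exact: lt0r_neq0.
    apply: ler_wpM2l; [exact: ltW | have := sqr_ge0 (t - (s - 1)); nra].
  have h2 : t^-1 * (t ^+ 2 + (s - 1)^+2) >= - 2 * (s - 1).
    have -> : - 2 * (s-1) = t^-1 * (- 2 * (t * (s-1))).
      by field; exact: lt0r_neq0.
    apply: ler_wpM2l; [exact: ltW | have := sqr_ge0 (t + (s - 1)); nra].
  rewrite /y us ler_norml; nra.
have tq : 0 < t `^ (q - 1) by rewrite powR_gt0.
have tqt : t `^ q = t `^ (q - 1) * t by rewrite mulrC mulr_powRB1// ltW.
have h1 := young_powR q01 y0 t0.
have h2 := tangent_gap_ge q01 u0; rewrite -/s in h2.
set G := 1 - q + q * u - u `^ q in h2 *.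
have h3 : q * (s - 1) ^+ 2 <= G / (1 - q).
  by rewrite ler_pdivlMr ?subr_gt0// mulrAC.
apply: (le_trans h1).
have h4 : q * y <= q * t + (1 + t^-1) * (G / (1 - q)).
  apply: (@le_trans _ _ (q * (t + (1 + t^-1) * (s - 1) ^+ 2))).
    by apply: ler_wpM2l => //; exact: ltW.
  rewrite mulrDr lerD2l mulrCA; apply: ler_wpM2l => //.
  by rewrite ltW// addr_gt0.
have := ler_wpM2l (ltW tq) h4.
rewrite tqt; set T := t `^ (q - 1); set g := G / _.
rewrite -!mulrA [(1 - q)^-1 * G]mulrC -/g; nra.
Qed.

Lemma powR_subadd q a b : 0 < q < 1 -> 0 <= a -> 0 <= b ->
  a `^ q <= b `^ q + `|b - a| `^ q.
Proof.
move=> /andP[q0 q1] a0 b0; have [ab|ba] := leP a b.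
  by apply: ler_wpDr; [exact: powR_ge0|apply: ge0_ler_powR => //; exact: ltW].
have agt0 : 0 < a by exact: le_lt_trans ba.
have [->|bn0] := eqVneq b 0.
  by rewrite sub0r normrN ger0_norm// lerDr powR_ge0.
have bgt0 : 0 < b by rewrite lt_neqAle eq_sym bn0.
have aq : 0 < a `^ q by exact: powR_gt0.
rewrite distrC gtr0_norm ?subr_gt0//.
have h1 : b / a <= (b / a) `^ q.
  by apply: ger1_powR; rewrite ?divr_gt0 ?ler_pdivrMr ?mul1r ?(ltW ba) ?(ltW q1).
have h2 : (a - b) / a <= ((a - b) / a) `^ q.
  apply: ger1_powR; last exact: ltW.
  by rewrite divr_gt0 ?subr_gt0// ler_pdivrMr// mul1r gerBl.
have e : b / a + (a - b) / a = 1 by rewrite -mulrDl addrC subrK divff ?gt_eqF.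
have := lerD h1 h2; rewrite e -(ler_pM2r aq) mul1r mulrDl.
rewrite -!powRM ?divr_ge0 ?subr_ge0 ?(ltW ba) ?(ltW agt0)//.
by rewrite !divfK ?gt_eqF.
Qed.

End PowerInequalities.

(** * The function [Hq] and the constants of the extremal profile *)

Section BellmanProfile.
Local Open Scope ring_scope.
Context {R : realType}.
Implicit Types q t u a b M z : R.

Lemma cvg_powR (T : Type) (F : set_system T) (FF : Filter F) (g : T -> R) q a :
  0 < a -> g x @[x --> F] --> a -> g x `^ q @[x --> F] --> a `^ q.
Proof.
move=> a0 ga; apply: (@continuous_cvg T R R F FF g (fun x => x `^ q) a _ ga).
apply/differentiable_continuous/derivable1_diffP/derivable_powR.
by rewrite in_itv/= andbT.
Qed.

Lemma IVT_pointwise (g : R -> R) a b v : a <= b ->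
  (forall x, a <= x <= b -> {for x, continuous g}) ->
  Num.min (g a) (g b) <= v <= Num.max (g a) (g b) ->
  exists2 x, a <= x <= b & g x = v.
Proof.
move=> ab cg /(@IVT R g a b v ab)[].
  apply: continuous_in_subspaceT => x; rewrite inE/= in_itv/=; exact: cg.
by move=> x; rewrite in_itv/= => ? <-; exists x.
Qed.

Lemma HqE q z : 0 < z -> Hq q z = z `^ q * (1 - q + q / z).
Proof. by move=> z0; rewrite /Hq powR_subr1//; field; exact: lt0r_neq0. Qed.

Lemma Hq1 q : Hq q 1 = 1.
Proof. by rewrite /Hq !powR1; ring. Qed.

(** By [HqE] the claim is an upper bound for [(a / b)^q]; the strict tangent
    bound gives it, because [(1 - a / b) (1 - 1 / a) >= 0]. *)
Lemma Hq_increasing q a b : 0 < q < 1 -> 1 <= a -> a < b -> Hq q a < Hq q b.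
Proof.
move=> q01 a1 ab; have /andP[q0 q1] := q01.
have a0 : 0 < a by exact: lt_le_trans a1.
have b0 : 0 < b by exact: lt_trans ab.
have bq : 0 < b `^ q by rewrite powR_gt0.
pose t := a / b.
have t0 : 0 < t by rewrite divr_gt0.
have t1 : t < 1 by rewrite ltr_pdivrMr// mul1r.
have aE : a = b * t by rewrite /t mulrC divfK ?gt_eqF.
rewrite !HqE// {1}aE powRM ?(ltW b0) ?(ltW t0)// -mulrA ltr_pM2l//.
have gap := tangent_gap_ge q01 (ltW t0).
have gap0 : 0 < q * (1 - q) * (Num.sqrt t - 1) ^+ 2.
  apply: mulr_gt0; first by apply: mulr_gt0; rewrite ?subr_gt0.
  rewrite lt_neqAle sqr_ge0 andbT eq_sym.
  rewrite sqrf_eq0 subr_eq0; apply/eqP => st.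
  by move: t1; rewrite -[t]sqr_sqrtr ?(ltW t0)// st expr1n ltxx.
have tq : t `^ q < 1 - q + q * t by rewrite -subr_gt0; exact: lt_le_trans gap.
have ia1 : a^-1 <= 1 by rewrite invf_le1.
have ia0 : 0 < a^-1 by rewrite invr_gt0.
have ka : 0 < 1 - q + q / a by nra.
apply: (@lt_le_trans _ _ ((1 - q + q * t) * (1 - q + q / a))).
  by rewrite ltr_pM2r.
have -> : q / b = q * (t / a).
  by rewrite /t; field; rewrite ?lt0r_neq0.
have ta : t <= 1 by exact: ltW.
have : 0 <= (1 - t) * (1 - a^-1) by rewrite mulr_ge0 ?subr_ge0.
rewrite -/(t / a); have := mulr_gt0 q0 (_ : 0 < 1 - q); rewrite subr_gt0 => /(_ q1).
set w := a^-1 in ia1 ia0 ka *.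
nra.
Qed.

Lemma Hq_le q a b : 0 < q < 1 -> 1 <= a -> 1 <= b -> Hq q a <= Hq q b -> a <= b.
Proof.
move=> q01 a1 b1; apply: contra_le => ba; exact: Hq_increasing.
Qed.

Lemma Hq_surj q y : 0 < q < 1 -> 1 <= y -> exists2 z, 1 <= z & Hq q z = y.
Proof.
move=> q01 y1; have /andP[q0 q1] := q01.
have y0 : 0 < y by exact: lt_le_trans y1.
have q'0 : 0 < 1 - q by rewrite subr_gt0.
have q'1 : 1 - q <= 1 by rewrite gerBl ltW.
pose Z := (y / (1 - q)) `^ q^-1.
have yq : 1 <= y / (1 - q) by rewrite ler_pdivlMr// mul1r (le_trans q'1).
have Z1 : 1 <= Z.
  rewrite [leLHS](_ : 1 = 1 `^ q^-1); last by rewrite powR1.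
  apply: ge0_ler_powR; rewrite ?nnegrE ?invr_ge0 ?(ltW q0)//.
  exact: le_trans yq.
have HZ : y <= Hq q Z.
  rewrite /Hq /Z -powRrM mulVf ?gt_eqF// powRr1 ?(le_trans _ yq)//.
  by rewrite mulrC divfK ?gt_eqF// lerDl mulr_ge0 ?powR_ge0 ?(ltW q0).
have cH x : 1 <= x <= Z -> {for x, continuous (Hq q)}.
  case/andP => /(lt_le_trans ltr01) x0 _.
  by rewrite /Hq; apply: cvgD; apply: cvgMr; apply: cvg_powR => //; exact: cvg_id.
have mM : Num.min (Hq q 1) (Hq q Z) <= y <= Num.max (Hq q 1) (Hq q Z).
  by rewrite Hq1 ge_min y1/= le_max HZ orbT.
by have [z /andP[z1 _] zy] := IVT_pointwise Z1 cH mM; exists z.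
Qed.

Lemma omega_Hq q b : 0 < q < 1 -> 1 <= b -> omega q (Hq q b) = b `^ q.
Proof.
move=> q01 b1; rewrite /omega pinvKV//; last by rewrite inE/= in_itv/= b1.
move=> x y; rewrite !inE/= !in_itv/= !andbT => x1 y1 e.
apply/le_anti/andP; split.
  by apply: (Hq_le q01 x1 y1); rewrite e lexx.
by apply: (Hq_le q01 y1 x1); rewrite e lexx.
Qed.

End BellmanProfile.

Section ExtremalProfile.
Local Open Scope ring_scope.
Context {R : realType}.
Variables (q f L : R).
Implicit Types (d b h : R).
Hypotheses (q01 : 0 < q < 1) (f0 : 0 < f) (fL : f <= L).

(** The extremal profile equals [L / b] off a set of mass [stopped_mass b].
    Inside this set the layers lose the proportion [d] of the mass at each step
    while the value is multiplied by [layer_ratio d b].  [profile_power d b] is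
    the integral of the power of exponent [q] of this profile.  [layer_ratio]
    is chosen so that the average over a layer and all the layers inside it is
    [b] times the value on that layer, and [stopped_mass] so that the total
    integral is [f]. *)
Definition stopped_mass b := (b * f - L) / (L * (b - 1)).

Definition layer_ratio d b := (1 - d / b) / (1 - d).

Definition profile_power d b :=
  (L / b) `^ q * (1 - stopped_mass b +
    stopped_mass b * d / (1 - (1 - d) * layer_ratio d b `^ q)).

Let q0 : 0 < q. Proof. by case/andP: q01. Qed.
Let q1 : q < 1. Proof. by case/andP: q01. Qed.
Let L0 : 0 < L. Proof. exact: lt_le_trans fL. Qed.

Lemma layer_ratio_gt0 d b : 0 < d < 1 -> 1 < b -> 0 < layer_ratio d b.
Proof.
move=> /andP[d0 d1] b1; rewrite divr_gt0 ?subr_gt0//.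
by rewrite ltr_pdivrMr ?mul1r ?(lt_trans d1)// (lt_trans _ b1).
Qed.

Lemma layer_decay_le d b : 0 < d < 1 -> 1 < b ->
  (1 - d) * layer_ratio d b `^ q <= 1 - d * (1 - q + q / b).
Proof.
move=> d01 b1; have /andP[d0 d1] := d01.
have r0 := layer_ratio_gt0 d01 b1.
have := powR_le_tangent q01 (ltW r0).
have d'0 : 0 < 1 - d by rewrite subr_gt0.
rewrite -(ler_pM2l d'0) => /le_trans; apply.
rewrite /layer_ratio le_eqVlt; apply/orP; left; apply/eqP.
by field; rewrite !lt0r_neq0 // (lt_trans _ b1).
Qed.

(** The tangent bound at the inverse of the ratio, that is, a lower bound for
    the power of the ratio; [N] below clears its denominators. *)
Lemma layer_decay_ge d b : 0 < d < 1 -> 1 < b ->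
  (1 - d) * (1 - (1 - d) * layer_ratio d b `^ q) <= d * (1 - q + q / b).
Proof.
move=> d01 b1; have /andP[d0 d1] := d01.
have d'0 : 0 < 1 - d by rewrite subr_gt0.
have r0 := layer_ratio_gt0 d01 b1.
have b0 : 0 < b by rewrite (lt_trans _ b1).
have ri0 : 0 < (layer_ratio d b)^-1 by rewrite invr_gt0.
have := powR_le_tangent q01 (ltW ri0).
rewrite -{1}(powR_inv1 (ltW r0)) powRAC powR_inv1 ?powR_ge0//.
have rq : 0 < layer_ratio d b `^ q by rewrite powR_gt0.
rewrite -(ler_pM2l rq) divff ?gt_eqF//.
set Q := _ `^ q in rq *.
have bi0 : 0 < b^-1 by rewrite invr_gt0.
have bi1 : b^-1 < 1 by rewrite invf_lt1.
set s := 1 - d / b.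
have s0 : 0 < s by rewrite /s; nra.
have sd : 1 - d < s by rewrite /s; nra.
have -> : (layer_ratio d b)^-1 = (1 - d) / s.
  by rewrite /layer_ratio -/s invf_div.
have ds1 : (1 - d) / s <= 1 by rewrite ler_pdivrMr// mul1r ltW.
have ds0 : 0 < (1 - d) / s by rewrite divr_gt0.
have e : (1 - d) / s * s = 1 - d by rewrite divfK ?gt_eqF.
set w := (1 - d) / s in ds1 ds0 e *.
move=> h.
pose N := (1 - q) * s + q * (1 - d).
have Nw : s * (1 - q + q * w) = N by rewrite /N -e; ring.
have hN : (1 - d) * s <= (1 - d) * Q * N.
  by rewrite -Nw -mulrA [Q * _]mulrCA ler_pM2l// ler_peMr ?(ltW s0).
have N1 : 1 - d <= N.
  have : 0 <= (1 - q) * (s - (1 - d)).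
    by rewrite mulr_ge0// subr_ge0 ltW.
  by rewrite /N mulrBr; lra.
have N0 : 0 < N by exact: lt_le_trans N1.
rewrite -(ler_pM2r N0).
have eN : N - (1 - d) * s = d * ((1 - q) * s + q * ((1 - d) / b)).
  by rewrite /N /s; ring.
set k := 1 - q + q / b.
have Kk : (1 - q) * s + q * ((1 - d) / b) <= k.
  apply: lerD.
    by rewrite ler_piMr ?subr_ge0 ?(ltW q1)// /s gerBl mulr_ge0 ?ltW.
  rewrite ler_pM2l// ler_piMl ?(ltW bi0)// gerBl ltW//.
have k0 : 0 < k by rewrite addr_gt0 ?subr_gt0// divr_gt0.
apply: (@le_trans _ _ ((1 - d) * (d * k))).
  rewrite -mulrA ler_pM2l// mulrBl mul1r.
  apply: (@le_trans _ _ (N - (1 - d) * s)); first by rewrite lerD2l lerN2.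
  by rewrite eN ler_pM2l.
by rewrite mulrC ler_pM2l// mulr_gt0.
Qed.

Lemma layer_decay_lt1 d b : 0 < d < 1 -> 1 < b ->
  (1 - d) * layer_ratio d b `^ q < 1.
Proof.
move=> d01 b1; apply: le_lt_trans (layer_decay_le d01 b1) _.
have /andP[d0 _] := d01.
rewrite ltrBlDr ltrDl mulr_gt0// addr_gt0 ?subr_gt0//.
by rewrite divr_gt0// (lt_trans _ b1).
Qed.

Lemma stopped_mass_itv b : 1 < b -> L / f < b -> 0 < stopped_mass b <= 1.
Proof.
move=> b1; rewrite ltr_pdivrMr// => Lbf.
have Lb : 0 < L * (b - 1) by rewrite mulr_gt0 ?subr_gt0.
rewrite divr_gt0 ?subr_gt0//= ler_pdivrMr// mul1r.
have b0 : 0 < b by exact: lt_trans b1.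
have : b * f <= b * L by rewrite ler_pM2l.
by nra.
Qed.

Let A := (1 - q) * L `^ q + q * L `^ (q - 1) * f.

(** The left-hand side is the limit of [profile_power d b] as [d] tends to 0. *)
Lemma profile_limit b : 1 < b ->
  (L / b) `^ q * (1 - stopped_mass b + stopped_mass b / (1 - q + q / b)) =
  A / Hq q b.
Proof.
move=> b1; have b0 : 0 < b by exact: lt_trans b1.
have bq : 0 < b `^ q by rewrite powR_gt0.
have Lq : 0 < L `^ q by rewrite powR_gt0.
have k0 : 0 < 1 - q + q / b by rewrite addr_gt0 ?subr_gt0 ?divr_gt0.
have e : b * (1 - q + q / b) = b * (1 - q) + q by field; exact: lt0r_neq0.
have k'0 : 0 < b * (1 - q) + q by rewrite -e mulr_gt0.
rewrite HqE// /A powR_subr1// -mulrA mulrC [in RHS]mulrC.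
rewrite powR_div ?(ltW L0)//.
rewrite /stopped_mass; field.
by rewrite [(1 - q) * b]mulrC !lt0r_neq0// subr_gt0.
Qed.

Lemma profile_power_le d b : 0 < d < 1 -> 1 < b -> L / f < b ->
  profile_power d b <= A / Hq q b.
Proof.
move=> d01 b1 Lb; have /andP[d0 d1] := d01.
have b0 : 0 < b by exact: lt_trans b1.
have /andP[t0 t1] := stopped_mass_itv b1 Lb.
have k0 : 0 < 1 - q + q / b by rewrite addr_gt0 ?subr_gt0 ?divr_gt0.
have w0 : 0 < 1 - (1 - d) * layer_ratio d b `^ q.
  by rewrite subr_gt0 layer_decay_lt1.
rewrite -profile_limit//; apply: ler_wpM2l; first exact: powR_ge0.
rewrite lerD2l -mulrA ler_pM2l// ler_pdivrMr// mulrC ler_pdivlMr//.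
by have := layer_decay_le d01 b1; lra.
Qed.

Lemma profile_power_ge d b : 0 < d < 1 -> 1 < b -> L / f < b ->
  (1 - d) * (A / Hq q b) <= profile_power d b.
Proof.
move=> d01 b1 Lb; have /andP[d0 d1] := d01.
have b0 : 0 < b by exact: lt_trans b1.
have /andP[t0 t1] := stopped_mass_itv b1 Lb.
have k0 : 0 < 1 - q + q / b by rewrite addr_gt0 ?subr_gt0 ?divr_gt0.
have w0 : 0 < 1 - (1 - d) * layer_ratio d b `^ q.
  by rewrite subr_gt0 layer_decay_lt1.
rewrite -profile_limit// mulrCA; apply: ler_wpM2l; first exact: powR_ge0.
rewrite mulrDr; apply: lerD.
  by rewrite ler_piMl ?subr_ge0// gerBl ltW.
rewrite -mulrA mulrCA ler_pM2l// ler_pdivlMr// mulrAC ler_pdivrMr//.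
exact: layer_decay_ge.
Qed.

Lemma profile_power_continuous d b : 0 < d < 1 -> 1 < b ->
  {for b, continuous (profile_power d)}.
Proof.
move=> d01 b1; have /andP[d0 d1] := d01.
have b0 : 0 < b by exact: lt_trans b1.
have cid : (x : R) @[x --> b] --> b by exact: cvg_id.
have cinv : x^-1 @[x --> b] --> b^-1 by apply: cvgV => //; exact: lt0r_neq0.
have cmass : stopped_mass x @[x --> b] --> stopped_mass b.
  apply: cvgM.
    by apply: cvgB; [exact: cvgMl|exact: cvg_cst].
  apply: cvgV; first by rewrite lt0r_neq0 ?mulr_gt0 ?subr_gt0.
  by apply: cvgMr; apply: cvgB; [exact: cid|exact: cvg_cst].
have cratio : layer_ratio d x @[x --> b] --> layer_ratio d b.
  apply: cvgMl; apply: cvgB; [exact: cvg_cst|exact: cvgMr].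
rewrite /profile_power; apply: cvgM.
  apply: cvg_powR; first by rewrite divr_gt0.
  exact: cvgMr.
apply: cvgD; first by apply: cvgB => //; exact: cvg_cst.
apply: cvgM; first exact: cvgMl.
apply: cvgV.
  by rewrite lt0r_neq0// subr_gt0 layer_decay_lt1.
apply: cvgB; first exact: cvg_cst.
apply: cvgMr; apply: cvg_powR => //; exact: layer_ratio_gt0.
Qed.

(** [profile_power d b] lies between [(1 - d) A / Hq q b] and [A / Hq q b].  So
    for [d] small it is above [h] at [b0] and below [h] at [b1], and some point
    in between gives [h] exactly. *)
Lemma profile_power_tuning h b0 b1 : 0 < h ->
  1 < b0 -> L / f < b0 -> b0 < b1 -> Hq q b1 = A / h ->
  exists d b, [/\ 0 < d < 1, b0 <= b & profile_power d b = h].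
Proof.
move=> h0 b01 Lb0 b0b1 Hb1.
have H0 : 0 < Hq q b0.
  by rewrite (lt_trans ltr01)// -(Hq1 q) Hq_increasing.
have H1 : 0 < Hq q b1 by rewrite (lt_trans H0)// Hq_increasing// ltW.
have A0 : 0 < A.
  apply: addr_gt0; first by rewrite mulr_gt0 ?subr_gt0 ?powR_gt0.
  by rewrite !mulr_gt0 ?powR_gt0.
have hE : h = A / Hq q b1 by rewrite Hb1 invf_div mulrC divfK ?lt0r_neq0.
have HH : Hq q b0 < Hq q b1 by rewrite Hq_increasing// ltW.
pose d := 1 - Hq q b0 / Hq q b1.
have d01 : 0 < d < 1.
  by rewrite subr_gt0 ltr_pdivrMr// mul1r HH/= gtrBl divr_gt0.
have b11 : 1 < b1 by exact: lt_trans b0b1.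
have Lb1 : L / f < b1 by exact: lt_trans b0b1.
have ge : h <= profile_power d b0.
  apply: le_trans (profile_power_ge d01 b01 Lb0).
  rewrite /d subKr {1}hE le_eqVlt; apply/orP; left; apply/eqP.
  by field; rewrite !lt0r_neq0.
have le : profile_power d b1 <= h by rewrite hE; exact: profile_power_le.
have mM : Num.min (profile_power d b0) (profile_power d b1) <= h <=
    Num.max (profile_power d b0) (profile_power d b1).
  by rewrite ge_min le orbT le_max ge.
have cP x : b0 <= x <= b1 -> {for x, continuous (profile_power d)}.
  by case/andP => x0 _; apply: profile_power_continuous => //; exact: lt_le_trans x0.
have [x /andP[bx _] xh] := IVT_pointwise (ltW b0b1) cP mM.
by exists d, x.
Qed.

End ExtremalProfile.

(** * Countable families of sets and the cubes of a tree *)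

Section CountableFamilies.
Context {d : measure_display} {X : measurableType d} {R : realType}.
Implicit Types F G : set (set X).

Lemma bigcup_fibre F (e : set X -> nat) n : {in F &, injective e} ->
  let S := \bigcup_(I in [set I | F I /\ e I = n]) I in F S \/ S = set0.
Proof.
move=> einj S; have [[I [FI eI]]|none] := pselect (exists I, F I /\ e I = n).
  left; rewrite /S (_ : \bigcup_(_ in _) _ = I)//.
  apply/seteqP; split => [x [J [FJ eJ] Jx]|x Ix]; last by exists I.
  by rewrite -(einj J I) ?inE// eJ eI.
by right; apply/seteqP; split => // x [J FJ _]; apply: none; exists J.
Qed.

Lemma countable_bigcup_measurable F : countable F ->
  (forall I, F I -> measurable I) -> measurable (\bigcup_(I in F) I).
Proof.
move=> /countable_injP[e einj] mF.
rewrite (_ : \bigcup_(I in F) I =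
    \bigcup_n (\bigcup_(I in [set I | F I /\ e I = n]) I)); last first.
  apply/seteqP; split => x [].
    by move=> I FI Ix; exists (e I) => //; exists I.
  by move=> n _ [I [FI _] Ix]; exists I.
by apply: bigcupT_measurable => n; case: (bigcup_fibre n einj) => [/mF|->].
Qed.

(** The sequence may take the empty value: a countable family can be finite. *)
Lemma countable_family_seq F : countable F -> trivIset F id ->
  exists S : (set X)^nat, [/\ forall n, F (S n) \/ S n = set0,
    trivIset setT S & \bigcup_n S n = \bigcup_(I in F) I].
Proof.
move=> /countable_injP[e einj] tF.
pose S n := \bigcup_(I in [set I | F I /\ e I = n]) I.
exists S; split.
- by move=> n; exact: bigcup_fibre einj.
- move=> i j _ _ [x [[I [FI <-] Ix] [J [FJ <-] Jx]]].
  by rewrite (tF I J FI FJ)//; exists x.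
- apply/seteqP; split => x [].
    by move=> n _ [I [FI _] Ix]; exists I.
  by move=> I FI Ix; exists (e I) => //; exists I.
Qed.

Lemma measurable_fun_pieces d' (Y : measurableType d') F (g : X -> Y) :
  countable F -> (forall I, F I -> measurable I) ->
  (forall x, exists2 I, F I & I x) ->
  (forall I x y, F I -> I x -> I y -> g x = g y) -> measurable_fun setT g.
Proof.
move=> cF mF covF gF _ B mB; rewrite setTI.
rewrite (_ : _ @^-1` _ = \bigcup_(I in [set I | F I /\ I `<=` g @^-1` B]) I).
  apply: countable_bigcup_measurable => [|I [/mF]//].
  by apply: sub_countable cF; apply: subset_card_le => I [].
apply/seteqP; split => [x gx|x [I [_ IB] /IB//]].
have [I FI Ix] := covF x; exists I => //; split => // y Iy /=.
by rewrite (gF I y x).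
Qed.

Variable mu : {measure set X -> \bar R}.

(** Countable additivity on both sides; the case [Z = setT] is the one that
    compares a part of a union of cubes with the whole union. *)
Lemma measure_bigcup_proportional F (Y Z : set X) (r : R) :
  countable F -> trivIset F id -> (forall I, F I -> measurable I) ->
  measurable Y -> measurable Z ->
  (forall I, F I -> mu (I `&` Y) = r%:E * mu (I `&` Z)) ->
  mu (\bigcup_(I in F) I `&` Y) = r%:E * mu (\bigcup_(I in F) I `&` Z).
Proof.
move=> cF tF mF mY mZ FYZ.
have [S [FS tS <-]] := countable_family_seq cF tF.
have mS n : measurable (S n) by case: (FS n) => [/mF//|->].
have tSI W : trivIset setT (fun n => S n `&` W).
  by move=> i j _ _ [x [[Six _] [Sjx _]]]; apply: tS => //; exists x.
rewrite !setI_bigcupl !measure_bigcup//.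
- rewrite -nneseriesZl; last by move=> i _; exact: measure_ge0.
  apply: eq_eseriesr => n _; case: (FS n) => [/FYZ//|->].
  by rewrite !set0I measure0 mule0.
- by move=> n _; exact: measurableI.
- by move=> n _; exact: measurableI.
Qed.

Lemma eq_integral_bigcup F (g1 g2 : X -> \bar R) :
  countable F -> trivIset F id -> (forall I, F I -> measurable I) ->
  measurable_fun setT g1 -> measurable_fun setT g2 ->
  (forall x, 0 <= g1 x) -> (forall x, 0 <= g2 x) ->
  (forall I, F I -> \int[mu]_(x in I) g1 x = \int[mu]_(x in I) g2 x) ->
  \int[mu]_(x in \bigcup_(I in F) I) g1 x =
  \int[mu]_(x in \bigcup_(I in F) I) g2 x.
Proof.
move=> cF tF mF mg1 mg2 g10 g20 FE.
have [S [FS tS <-]] := countable_family_seq cF tF.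
have mS n : measurable (S n) by case: (FS n) => [/mF//|->].
have mU : measurable (\bigcup_n S n) by exact: bigcupT_measurable.
rewrite !ge0_integral_bigcup//; last 2 first.
- exact: measurable_funS mg2.
- exact: measurable_funS mg1.
apply: eq_eseriesr => n _; case: (FS n) => [/FE//|->].
by rewrite !integral_set0.
Qed.

Lemma integral_cstT (P : probability X R) (r : \bar R) :
  \int[P]_x (cst r x) = r.
Proof.
by rewrite integral_cst// [X in _ * X](_ : _ = 1) ?mule1//; exact: probability_setT.
Qed.

End CountableFamilies.

Section TreeCubes.
Context {d : measure_display} {X : measurableType d} {R : realType}.
Variables (mu : probability X R) (C : set X -> set (set X)) (T : set (set X)).
Hypothesis tree : is_tree_with mu C T.
Implicit Types I J K : set X.

Lemma tree_level_sub m I : tree_level C m I -> T I.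
Proof. by rewrite (tree_levels tree) => mI; exists m. Qed.

Lemma tree_has_level I : T I -> exists m, tree_level C m I.
Proof. by rewrite (tree_levels tree) => -[m _ mI]; exists m. Qed.

Lemma tree_child_subset I J : T I -> C I J -> J `<=` I.
Proof.
by move=> TI CJ; rewrite [X in _ `<=` X](tree_cover tree TI) => x Jx; exists J.
Qed.

Lemma tree_level_cover m x : exists2 I, tree_level C m I & I x.
Proof.
elim: m => [|m [I mI Ix]]; first by exists setT.
move: Ix; rewrite (tree_cover tree (tree_level_sub mI)) => -[J CJ Jx].
by exists J => //; exists I.
Qed.

Lemma tree_level_unique m I J x :
  tree_level C m I -> tree_level C m J -> I x -> J x -> I = J.
Proof.
elim: m I J => [|m IH] I J /=; first by move=> -> ->.
move=> [I' mI' CI] [J' mJ' CJ] Ix Jx.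
have TI' := tree_level_sub mI'; have TJ' := tree_level_sub mJ'.
have e : I' = J'.
  by apply: IH => //; [exact: (tree_child_subset TI' CI)|
    exact: (tree_child_subset TJ' CJ)].
rewrite -e in CJ; apply: (tree_disjoint tree TI') => //.
by exists x.
Qed.

Lemma tree_level_nested m p I J x : (m <= p)%N ->
  tree_level C m I -> tree_level C p J -> I x -> J x -> J `<=` I.
Proof.
move=> mp mI + Ix; elim: p mp J => [|p IH] mp J.
  move: mp mI; rewrite leqn0 => /eqP -> mI pJ Jx.
  by rewrite (tree_level_unique mI pJ Ix Jx).
move: mp; rewrite leq_eqVlt => /predU1P[mp|mp pJ Jx].
  by rewrite -mp => pJ Jx; rewrite (tree_level_unique mI pJ Ix Jx).
case: pJ => K pK CJ.
have JK := tree_child_subset (tree_level_sub pK) CJ.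
by apply: (subset_trans JK); apply: IH => //; exact: JK.
Qed.

Lemma tree_level_countable m : countable (tree_level C m).
Proof.
elim: m => [|m IH] /=; first exact: countable1.
apply: bigcup_countable => // I mI.
exact: (tree_countable tree (tree_level_sub mI)).
Qed.

Lemma tree_is_countable : countable T.
Proof.
rewrite (tree_levels tree); apply: bigcup_countable => // m _.
exact: tree_level_countable.
Qed.

Lemma tree_subfamily_countable F : F `<=` T -> countable F.
Proof.
by move=> FT; apply: sub_countable tree_is_countable; exact: subset_card_le.
Qed.

(** The maximal members of [G] are disjoint because cubes are nested.  They
    cover as much as [G] does since a point of a member of [G] lies in a member
    of [G] of least level, and this one is maximal. *)
Lemma maximal_cubes G : G `<=` T -> exists F, [/\ F `<=` G, trivIset F id &
  \bigcup_(I in F) I = \bigcup_(I in G) I].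
Proof.
move=> GT; pose F := [set I | G I /\ forall K, G K -> I `<=` K -> K `<=` I].
exists F; split; first by move=> I [].
- move=> I J [GI maxI] [GJ maxJ] [x [Ix Jx]].
  have [m mI] := tree_has_level (GT _ GI); have [p pJ] := tree_has_level (GT _ GJ).
  apply/seteqP; have [mp|/ltnW pm] := leqP m p.
    have JI := tree_level_nested mp mI pJ Ix Jx.
    by split=> //; exact: maxJ.
  have IJ := tree_level_nested pm pJ mI Jx Ix.
  by split=> //; exact: maxI.
- apply/seteqP; split => x [I]; first by move=> [GI _] Ix; exists I.
  move=> GI Ix.
  have ex : exists m, `[< exists J, [/\ tree_level C m J, G J & J x] >].
    have [m mI] := tree_has_level (GT _ GI).
    by exists m; apply/asboolP; exists I.
  case: (ex_minnP ex) => m /asboolP[J [mJ GJ Jx]] minm.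
  exists J => //; split => // K GK JK.
  have [p pK] := tree_has_level (GT _ GK).
  have mp : (m <= p)%N.
    by apply: minm; apply/asboolP; exists K; split => //; exact: JK.
  by apply: (tree_level_nested mp mJ pK Jx); exact: JK.
Qed.

Lemma tree_small_cubes (e : R) : (0 < e)%R ->
  \forall m \near \oo, forall I, tree_level C m I -> mu I < e%:E.
Proof.
move=> e0.
have : nbhs (0 : \bar R) [set y | y < e%:E].
  by apply: open_nbhs_nbhs; split; [exact: open_ereal_lt_ereal|rewrite /= lte_fin].
move=> /(tree_mesh tree) near_lt.
have : \forall m \near \oo, ereal_sup [set mu I | I in tree_level C m] < e%:E.
  exact: near_lt.
apply: filterS => m lt I mI.
by apply: le_lt_trans lt; apply: ereal_sup_ubound; exists I.
Qed.

(** Greedy choice: run through all the cubes inside [I] and keep a cube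
    whenever the union stays of measure at most [a].  If the final union [V] had
    a smaller measure, every cube of a fine enough level would have been kept,
    and [V] would be all of [I].  The maximal cubes inside [V] then give a
    disjoint family. *)
Lemma tree_family_of_mass I (a : R) : T I -> (0 <= a)%R -> a%:E <= mu I ->
  exists F, [/\ F `<=` T, trivIset F id, (forall J, F J -> J `<=` I) &
    mu (\bigcup_(J in F) J) = a%:E].
Proof.
move=> TI a0 aI; have /countable_injP[e einj] := tree_is_countable.
(* [S] enumerates the cubes inside [I]; indices without a cube repeat [I]. *)
pose P n := [set K | [/\ T K, K `<=` I & e K = n]].
pose S n := xget I (P n).
have PS n : T (S n) /\ S n `<=` I.
  by rewrite /S; case: xgetP => [K _ []|_]; split.
have SP K : T K -> K `<=` I -> S (e K) = K.
  move=> TK KI; rewrite /S; case: xgetP => [J _ [TJ _ eJ]|/(_ K)[]//].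
  by apply: einj => //; rewrite inE.
have mS n : measurable (S n) := tree_measurable tree (PS n).1.
pose U := fix U n := if n is n'.+1 then
  if mu (U n' `|` S n') <= a%:E then U n' `|` S n' else U n' else set0.
have mU n : measurable (U n).
  by elim: n => //= n IH; case: ifP => // _; exact: measurableU.
have Ua n : mu (U n) <= a%:E.
  by elim: n => [|n IH]; rewrite /= ?measure0 ?lee_fin//; case: ifP.
have UI n : U n `<=` I.
  elim: n => //= n IH; case: ifP => // _.
  by rewrite subUset; split=> //; exact: (PS n).2.
have US n : U n `<=` U n.+1 by rewrite /=; case: ifP => _ x Ux //; left.
pose V := \bigcup_n U n.
have mV : measurable V by exact: bigcupT_measurable.
have ndU : nondecreasing_seq U.
  by apply/nondecreasing_seqP => n; apply/subsetPset.
have Va : mu V <= a%:E.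
  have cU := @nondecreasing_cvg_mu _ _ _ mu _ mU mV ndU.
  rewrite -(cvg_lim _ cU)//; apply: lime_le; first exact: cvgP cU.
  by apply: nearW => n; exact: Ua.
have VI : V `<=` I by move=> x [n _ /UI].
have Vfin : mu V \is a fin_num by exact: fin_num_measure.
have aV : mu V = a%:E.
  apply/eqP; rewrite eq_le Va leNgt; apply/negP => ltVa.
  have gap0 : (0 < a - fine (mu V))%R.
    by rewrite subr_gt0 -lte_fin fineK.
  have [p pI] := tree_has_level TI.
  have [N _ small] := tree_small_cubes gap0.
  pose m := maxn N p.
  have IV : I `<=` V.
    move=> x Ix; have [K mK Kx] := tree_level_cover m x.
    have KI : K `<=` I by exact: (tree_level_nested (leq_maxr N p) pI mK Ix Kx).
    have TK := tree_level_sub mK; have SK := SP K TK KI.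
    exists (e K).+1 => //=; rewrite SK ifT; first by right.
    apply: (le_trans (measureU2 mu (mU _) (tree_measurable tree TK))).
    have -> : a%:E = mu V + (a - fine (mu V))%:E.
      by rewrite -{1}(fineK Vfin) -EFinD addrC subrK.
    apply: leeD; first by apply: le_measure; rewrite ?inE// => y Uy; exists (e K).
    by apply/ltW/(small m) => //=; exact: leq_maxl.
  move: aI; rewrite leNgt => /negP; apply; apply: le_lt_trans ltVa.
  by apply: le_measure; rewrite ?inE//; exact: (tree_measurable tree TI).
pose G := [set K | T K /\ K `<=` V].
have [F [FG tF UF]] := @maximal_cubes G (fun K => @proj1 _ _).
have GV : \bigcup_(K in G) K = V.
  apply/seteqP; split => [x [K [_ KV] /KV//]|x [n _ Ux]].
  elim: n Ux => [//|n IH] /=; case: ifP => // le [/IH//|Sx].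
  exists (S n) => //; split; first exact: (PS n).1.
  by move=> y Sy; exists n.+1 => //=; rewrite le; right.
exists F; split=> //.
- by move=> K /FG[].
- by move=> K /FG[_ KV]; exact: subset_trans VI.
- by rewrite UF GV.
Qed.

End TreeCubes.

(** * Running maxima along the tree and the integral inequality *)

Section StoppedMaximal.
Context {d : measure_display} {X : measurableType d} {R : realType}.
Variables (mu : probability X R) (C : set X -> set (set X)) (T : set (set X)).
Hypothesis tree : is_tree_with mu C T.
Variables (f L q : R) (phi : X -> R).
Hypotheses (q01 : (0 < q < 1)%R) (f0 : (0 < f)%R) (fL : (f <= L)%R).
Hypotheses (phi0 : forall x, (0 <= phi x)%R) (mphi : measurable_fun setT phi).
Hypothesis (iphi : \int[mu]_x (phi x)%:E = f%:E).

Let q0 : (0 < q)%R. Proof. by case/andP: q01. Qed.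
Let q1 : (q < 1)%R. Proof. by case/andP: q01. Qed.
Let L0 : (0 < L)%R. Proof. exact: lt_le_trans fL. Qed.

Definition cube_avg (I : set X) : R := fine (Av mu I phi).

Lemma integral_cube I : T I ->
  [/\ Av mu I phi = (cube_avg I)%:E, (0 <= cube_avg I)%R &
     \int[mu]_(x in I) (phi x)%:E = (cube_avg I)%:E * mu I].
Proof.
move=> TI; have mI := tree_measurable tree TI.
have mE : measurable_fun setT (EFin \o phi) by exact/measurable_EFinP.
have i0 : 0 <= \int[mu]_(x in I) (phi x)%:E.
  by apply: integral_ge0 => x _; rewrite lee_fin.
have iI : \int[mu]_(x in I) (phi x)%:E \is a fin_num.
  rewrite ge0_fin_numE//; apply: (@le_lt_trans _ _ f%:E); last exact: ltry.
  by rewrite -iphi; apply: ge0_subset_integral => // x _; rewrite lee_fin.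
have mui := tree_pos tree TI.
have muf : mu I \is a fin_num by exact: fin_num_measure.
move: muf mui iI i0; rewrite /cube_avg /Av.
case: (mu I) => // m _; rewrite lte_fin => m0.
case: (\int[mu]_(_ in I) _) => // a _; rewrite lee_fin => a0.
rewrite inver gt_eqF// -EFinM /= -EFinM divfK ?gt_eqF//; split=> //.
by rewrite divr_ge0// ltW.
Qed.

(** The cube of level [m] containing [x], as a union to avoid a choice. *)
Definition cube m x : set X :=
  \bigcup_(I in [set I | tree_level C m I /\ I x]) I.

Lemma cubeE m I x : tree_level C m I -> I x -> cube m x = I.
Proof.
move=> mI Ix; apply/seteqP; split => [y [J [mJ Jx] Jy]|y Iy]; last by exists I.
by rewrite (tree_level_unique tree mI mJ Ix Jx).
Qed.

Definition level_avg m x := cube_avg (cube m x).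

Fixpoint running_max m x : R :=
  if m is m'.+1 then Num.max (running_max m' x) (level_avg m x) else L.

Lemma level_avg_const m I x y : tree_level C m I -> I x -> I y ->
  level_avg m x = level_avg m y.
Proof. by move=> mI Ix Iy; rewrite /level_avg !(cubeE mI). Qed.

Lemma level_avg_ge0 m x : (0 <= level_avg m x)%R.
Proof.
have [I mI Ix] := tree_level_cover tree m x.
rewrite /level_avg (cubeE mI Ix).
by have [] := integral_cube (tree_level_sub tree mI).
Qed.

Lemma running_max_const m p I x y : (m <= p)%N -> tree_level C p I ->
  I x -> I y -> running_max m x = running_max m y.
Proof.
move=> + pI Ix Iy; elim: m => [//|m IH] mp /=; rewrite IH ?(ltnW mp)//.
have [J mJ Jx] := tree_level_cover tree m.+1 x.
have IJ := tree_level_nested tree mp mJ pI Jx Ix.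
by rewrite (level_avg_const mJ Jx (IJ _ Iy)).
Qed.

Lemma measurable_level_const m (g : X -> R) :
  (forall I x y, tree_level C m I -> I x -> I y -> g x = g y) ->
  measurable_fun setT g.
Proof.
apply: measurable_fun_pieces.
- exact: tree_level_countable tree m.
- by move=> I mI; exact: (tree_measurable tree (tree_level_sub tree mI)).
- by move=> x; exact: tree_level_cover tree m x.
Qed.

Lemma measurable_level_avg m : measurable_fun setT (level_avg m).
Proof. by apply: (@measurable_level_const m) => I x y; exact: level_avg_const. Qed.

Lemma measurable_running_max m : measurable_fun setT (running_max m).
Proof. by apply: (@measurable_level_const m) => I x y; exact: running_max_const. Qed.

Lemma running_max_ge m x : (L <= running_max m x)%R.
Proof. by elim: m => //= m IH; rewrite le_max IH. Qed.

Lemma running_max_nondecreasing x :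
  {homo (running_max ^~ x) : m n / (m <= n)%N >-> (m <= n)%R}.
Proof. by apply/nondecreasing_seqP => n /=; rewrite le_max lexx. Qed.

(** The running maximum starts at [L] rather than at the average over the
    whole space; this loses nothing since that average is [f <= L]. *)
Lemma running_max_sup x : maxe (maximal mu T phi x) L%:E =
  ereal_sup (range (fun m => (running_max m x)%:E)).
Proof.
apply/eqP; rewrite eq_le; apply/andP; split.
  rewrite ge_max; apply/andP; split; last first.
    by apply: ereal_sup_ubound; exists 0%N.
  apply: ge_ereal_sup => _ [I [TI Ix] <-].
  under eq_fun do rewrite ger0_norm//.
  have [m mI] := tree_has_level tree TI.
  have [-> _ _] := integral_cube TI.
  apply: (@le_trans _ _ (running_max m x)%:E); last first.
    by apply: ereal_sup_ubound; exists m.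
  rewrite lee_fin; case: m mI => [|m] mI.
    apply: le_trans fL; rewrite -lee_fin.
    have [<- _ _] := integral_cube TI.
    by rewrite mI /Av probability_setT inve1 mule1 iphi.
  by rewrite /= le_max /level_avg (cubeE mI Ix) lexx orbT.
apply: ge_ereal_sup => _ [m _ <-]; rewrite le_max.
elim: m => [|m IH]; first by rewrite lexx orbT.
have [I mI Ix] := tree_level_cover tree m.+1 x.
have TI := tree_level_sub tree mI.
have [le|/ltW lt] := leP (level_avg m.+1 x) (running_max m x).
  by rewrite /= (max_idPl le).
rewrite /= (max_idPr lt); apply/orP; left.
rewrite /maximal; apply: ereal_sup_ubound; exists I => //.
rewrite /level_avg (cubeE mI Ix); have [<- _ _] := integral_cube TI.
by under eq_fun do rewrite ger0_norm//.
Qed.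

(** For [psi = phi] and [w] a running maximum, the quantity whose integral
    decreases from level to level. *)
Definition kolmogorov_integrand (w psi : X -> R) x : R :=
  ((1 - q) * w x `^ q + q * (psi x * w x `^ (q - 1)))%R.

Lemma kolmogorov_integrand_ge0 (w psi : X -> R) : (forall x, 0 <= psi x)%R ->
  forall x, (0 <= kolmogorov_integrand w psi x)%R.
Proof.
move=> psi0 x; rewrite addr_ge0// mulr_ge0 ?subr_ge0 ?(ltW q0) ?(ltW q1) ?powR_ge0//.
by rewrite mulr_ge0 ?powR_ge0.
Qed.

Lemma measurable_kolmogorov_integrand (w psi : X -> R) :
  measurable_fun setT w -> measurable_fun setT psi ->
  measurable_fun setT (kolmogorov_integrand w psi).
Proof.
move=> mw mpsi; apply: measurable_funD; apply: measurable_funM => //.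
  exact: measurableT_comp (measurable_powR _) mw.
apply: measurable_funM => //.
exact: measurableT_comp (measurable_powR _) mw.
Qed.

(** Conditioning on level [p]: the integrand is affine in [phi], with
    coefficients that are constant on each cube of level [p]. *)
Lemma integral_level_avg p (w : X -> R) : (forall x, 0 <= w x)%R ->
  (forall I x y, tree_level C p I -> I x -> I y -> w x = w y) ->
  \int[mu]_x (kolmogorov_integrand w phi x)%:E =
  \int[mu]_x (kolmogorov_integrand w (level_avg p) x)%:E.
Proof.
move=> w0 wc; have mw := measurable_level_const wc.
have cover : \bigcup_(I in tree_level C p) I = setT.
  apply/seteqP; split => // x _.
  by have [I pI Ix] := tree_level_cover tree p x; exists I.
rewrite -cover; apply: eq_integral_bigcup.
- exact: (tree_level_countable tree p).
- by move=> I J pI pJ [x [Ix Jx]]; exact: (tree_level_unique tree pI pJ Ix Jx).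
- by move=> I pI; exact: (tree_measurable tree (tree_level_sub tree pI)).
- by apply/measurable_EFinP; exact: measurable_kolmogorov_integrand.
- apply/measurable_EFinP; apply: measurable_kolmogorov_integrand => //.
  exact: measurable_level_avg.
- by move=> x; rewrite lee_fin; exact: kolmogorov_integrand_ge0.
- move=> x; rewrite lee_fin; apply: kolmogorov_integrand_ge0 => y.
  exact: level_avg_ge0.
move=> I pI; have TI := tree_level_sub tree pI.
have mI := tree_measurable tree TI.
have [z Iz] : exists z, I z.
  have := tree_pos tree TI.
  have [->|/set0P[z Iz] _] := eqVneq I set0; last by exists z.
  by rewrite measure0 ltxx.
pose a := ((1 - q) * w z `^ q)%R; pose b := (q * w z `^ (q - 1))%R.
have a0 : (0 <= a)%R by rewrite mulr_ge0 ?subr_ge0 ?(ltW q1) ?powR_ge0.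
have b0 : (0 <= b)%R by rewrite mulr_ge0 ?(ltW q0) ?powR_ge0.
have E (psi : X -> R) : measurable_fun setT psi -> (forall x, 0 <= psi x)%R ->
    \int[mu]_(x in I) (kolmogorov_integrand w psi x)%:E =
    a%:E * mu I + b%:E * \int[mu]_(x in I) (psi x)%:E.
  move=> mpsi psi0.
  rewrite (@eq_integral _ _ _ mu I (fun x => a%:E + b%:E * (psi x)%:E)); last first.
    move=> x /[!inE] Ix; rewrite -EFinM -EFinD /kolmogorov_integrand (wc I x z)//.
    by congr (_ + _)%:E; rewrite /b mulrA mulrAC.
  have mp : measurable_fun I (EFin \o psi).
    by apply: (@measurable_funS _ _ _ _ setT) => //; exact/measurable_EFinP.
  rewrite ge0_integralD//.
  - rewrite integral_cst// ge0_integralZl_EFin//.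
    by move=> x _; rewrite lee_fin.
  - by move=> x _; rewrite -EFinM lee_fin mulr_ge0.
  - exact: measurable_funeM.
rewrite !E//; [|exact: measurable_level_avg|exact: level_avg_ge0].
congr (_ + _ * _); have [_ _ ->] := integral_cube TI.
rewrite (@eq_integral _ _ _ mu I (fun=> (cube_avg I)%:E)) ?integral_cst//.
by move=> x /[!inE] Ix; rewrite /level_avg (cubeE pI Ix).
Qed.

(** After conditioning on level [m + 1] the inequality is pointwise: either the
    maximum does not move, or it jumps to the new average [y] and the
    integrand, now [y^q], is bounded by Young's inequality. *)
Lemma running_max_step m :
  \int[mu]_x (kolmogorov_integrand (running_max m.+1) phi x)%:E <=
  \int[mu]_x (kolmogorov_integrand (running_max m) phi x)%:E.
Proof.
have rm0 n x : (0 <= running_max n x)%R := le_trans (ltW L0) (running_max_ge n x).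
have swap n : (n <= m.+1)%N ->
    \int[mu]_x (kolmogorov_integrand (running_max n) phi x)%:E =
    \int[mu]_x (kolmogorov_integrand (running_max n) (level_avg m.+1) x)%:E.
  move=> nm; apply: integral_level_avg => [x|I x y]; first exact: rm0.
  exact: running_max_const.
rewrite (swap m.+1 (leqnn _)) (swap m (leqnSn _)).
have mk n : measurable_fun setT
    (fun x => (kolmogorov_integrand (running_max n) (level_avg m.+1) x)%:E).
  apply/measurable_EFinP; apply: measurable_kolmogorov_integrand.
    exact: measurable_running_max.
  exact: measurable_level_avg.
apply: ge0_le_integral => //.
  by move=> x _; rewrite lee_fin kolmogorov_integrand_ge0//; exact: level_avg_ge0.
move=> x _; rewrite lee_fin /kolmogorov_integrand [running_max m.+1 x]/=.
set y := level_avg m.+1 x; set M := running_max m x.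
have M0 : (0 < M)%R by exact: (lt_le_trans L0 (running_max_ge m x)).
case: (leP M y) => // My; have y0 : (0 < y)%R by exact: (lt_le_trans M0 My).
rewrite mulr_powRB1 ?(ltW y0)// -mulrDl subrK mul1r addrC.
by apply: young_powR => //; exact: ltW.
Qed.

Lemma running_max_integral m :
  \int[mu]_x (kolmogorov_integrand (running_max m) phi x)%:E <=
  ((1 - q) * L `^ q + q * L `^ (q - 1) * f)%:E.
Proof.
elim: m => [|m IH]; last exact: le_trans (running_max_step m) IH.
rewrite (@integral_level_avg 0)//; last by move=> x; exact: ltW.
rewrite (@eq_integral _ _ _ mu setT
    (cst ((1 - q) * L `^ q + q * L `^ (q - 1) * f)%:E)) ?integral_cstT//.
move=> x _; rewrite /kolmogorov_integrand /level_avg (@cubeE 0 setT)//.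
have -> : cube_avg setT = f.
  apply/EFin_inj; have [<- _ _] := integral_cube (tree_root tree).
  by rewrite /Av probability_setT inve1 mule1.
by rewrite [running_max 0 x]/=; congr EFin; ring.
Qed.

Lemma running_max_cvg x : (running_max m x)%:E @[m --> \oo] -->
  maxe (maximal mu T phi x) L%:E.
Proof.
rewrite running_max_sup; apply: ereal_nondecreasing_cvgn => m n mn.
by rewrite lee_fin; exact: running_max_nondecreasing.
Qed.

Lemma measurable_maximal :
  measurable_fun setT (fun x => maxe (maximal mu T phi x) L%:E).
Proof.
apply: (@emeasurable_fun_cvg _ _ _ _ (fun m x => (running_max m x)%:E)).
  by move=> m; apply/measurable_EFinP; exact: measurable_running_max.
by move=> x _; exact: running_max_cvg.
Qed.

Lemma maximal_ge x : L%:E <= maxe (maximal mu T phi x) L%:E.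
Proof. by rewrite le_max lexx orbT. Qed.

(** Fatou's lemma along the running maxima.  Where the maximal function is
    infinite the integrands tend to infinity, so this happens on a null set
    only; [N] is a real-valued version of the maximal function. *)
Lemma kolmogorov_inequality : exists N : X -> R,
  [/\ measurable_fun setT N, forall x, (L <= N x)%R,
    {ae mu, forall x, maxe (maximal mu T phi x) L%:E = (N x)%:E} &
    \int[mu]_x (kolmogorov_integrand N phi x)%:E <=
    ((1 - q) * L `^ q + q * L `^ (q - 1) * f)%:E].
Proof.
set A := (_ + _)%R.
pose M x := maxe (maximal mu T phi x) L%:E.
pose N x := Num.max L (fine (M x)).
pose g m x := (kolmogorov_integrand (running_max m) phi x)%:E.
pose G x := limn_einf (g ^~ x).
have mg m : measurable_fun setT (g m).
  apply/measurable_EFinP/measurable_kolmogorov_integrand => //.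
  exact: measurable_running_max.
have g0 m x : 0 <= g m x by rewrite lee_fin kolmogorov_integrand_ge0.
have mN : measurable_fun setT N.
  apply: measurable_maxr => //.
  by apply: measurableT_comp; [exact: fine_measurable|exact: measurable_maximal].
have ML x : L%:E <= M x := maximal_ge x.
have NL x : (L <= N x)%R by rewrite le_max lexx.
have NE x : M x \is a fin_num -> M x = (N x)%:E.
  move=> Mfin; rewrite /N -[LHS]fineK//; congr EFin; apply/esym/max_idPr.
  by rewrite -lee_fin fineK.
have gfin x : M x \is a fin_num ->
    g m x @[m --> \oo] --> (kolmogorov_integrand N phi x)%:E.
  move=> Mfin; have N0 : (0 < N x)%R by exact: lt_le_trans (NL x).
  have cN : running_max m x @[m --> \oo] --> N x.
    by have := @running_max_cvg x; rewrite -/(M x) NE// => /fine_cvg.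
  apply: cvg_EFin; first exact: nearW.
  apply: cvgD; apply: cvgMr; first exact: cvg_powR.
  by apply: cvgMr; exact: cvg_powR.
have ginf x : M x = +oo -> g m x @[m --> \oo] --> +oo.
  move=> Moo; apply/cvgeyPge => K.
  have := @running_max_cvg x; rewrite -/(M x) Moo.
  move=> /cvgeyPge/(_ ((`|K| / (1 - q)) `^ q^-1)%R); apply: filterS => m.
  rewrite lee_fin => hm; rewrite lee_fin; apply: (le_trans (ler_norm K)).
  have K0 : (0 <= `|K| / (1 - q))%R by rewrite divr_ge0// subr_ge0 ltW.
  have KE : (`|K| / (1 - q) = ((`|K| / (1 - q)) `^ q^-1) `^ q)%R.
    by rewrite -powRrM mulVf ?gt_eqF// powRr1.
  apply: ler_wpDr.
    by rewrite mulr_ge0 ?(ltW q0)// mulr_ge0// powR_ge0.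
  rewrite mulrC -ler_pdivrMr ?subr_gt0// KE.
  apply: ge0_ler_powR; rewrite ?(ltW q0) ?nnegrE ?powR_ge0//.
  exact: le_trans (ltW L0) (running_max_ge m x).
have Gfin x : M x \is a fin_num -> G x = (kolmogorov_integrand N phi x)%:E.
  by move=> /gfin/cvg_limn_einf_sup[].
have Ginf x : M x = +oo -> G x = +oo.
  by move=> /ginf/cvg_limn_einf_sup[].
have Mcase x : M x \is a fin_num \/ M x = +oo.
  by move: (ML x); case: (M x) => [r|_|//]; [left|right].
have G0 x : 0 <= G x.
  have [/Gfin ->|/Ginf ->//] := Mcase x.
  by rewrite lee_fin kolmogorov_integrand_ge0.
have Gcvg x : g m x @[m --> \oo] --> G x.
  have [Mfin|Moo] := Mcase x; first by rewrite Gfin//; exact: gfin.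
  by rewrite Ginf//; exact: ginf.
have mG : measurable_fun setT G.
  exact: (@emeasurable_fun_cvg _ _ _ _ g).
have iG : \int[mu]_x G x <= A%:E.
  apply: le_trans (fatou mu measurableT mg (fun m x _ => g0 m x)) _.
  have cg : cvgn (fun m => \int[mu]_x g m x).
    apply: ereal_nonincreasing_is_cvgn; apply/nonincreasing_seqP => m.
    exact: running_max_step.
  rewrite is_cvg_limn_einfE//; apply: lime_le => //.
  by apply: nearW => m; exact: running_max_integral.
have intG : mu.-integrable setT G.
  apply/integrableP; split => //.
  rewrite (eq_integral G) => [|x _]; last by rewrite gee0_abs.
  by apply: le_lt_trans iG _; exact: ltry.
exists N; split => //.
  apply: filterS (integrable_ae measurableT intG) => x /(_ Logic.I) Gxfin.
  apply: NE; have [//|/Ginf Gy] := Mcase x.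
  by move: Gxfin; rewrite Gy.
apply: le_trans iG; apply: ge0_le_integral => //.
- by move=> x _; rewrite lee_fin kolmogorov_integrand_ge0.
- by apply/measurable_EFinP; exact: measurable_kolmogorov_integrand.
- by move=> x _; have [/Gfin ->|/Ginf ->] := Mcase x; rewrite ?leey.
Qed.

End StoppedMaximal.

(** * Stability of the integral inequality *)

Section RealIntegrals.
Local Open Scope ring_scope.
Context {d : measure_display} {X : measurableType d} {R : realType}.
Variable mu : probability X R.
Implicit Types g : X -> R.

Definition mean g : R := \int[mu]_x g x.

Definition has_mean g := mu.-integrable setT (EFin \o g).

Lemma meanE g : has_mean g -> (\int[mu]_x (g x)%:E)%E = (mean g)%:E.
Proof.
move=> ig; rewrite /mean /Rintegral fineK//.
exact: (@integrable_fin_num _ _ _ mu setT measurableT _ ig).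
Qed.

Lemma ge0_has_mean g r : measurable_fun setT g -> (forall x, 0 <= g x) ->
  (\int[mu]_x (g x)%:E <= r%:E)%E -> has_mean g.
Proof.
move=> mg g0 gr; apply/integrableP; split; first exact/measurable_EFinP.
rewrite (eq_integral (EFin \o g)) => [|x _]; last by rewrite gee0_abs ?lee_fin.
by apply: le_lt_trans gr _; exact: ltry.
Qed.

Lemma has_meanD g1 g2 : has_mean g1 -> has_mean g2 ->
  has_mean (fun x => g1 x + g2 x).
Proof. by move=> i1 i2; exact: (integrableD measurableT i1 i2). Qed.

Lemma has_meanZ r g : has_mean g -> has_mean (fun x => r * g x).
Proof. by move=> ig; exact: (integrableZl measurableT r ig). Qed.

Lemma meanD g1 g2 : has_mean g1 -> has_mean g2 ->
  mean (fun x => g1 x + g2 x) = mean g1 + mean g2.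
Proof. by move=> i1 i2; rewrite /mean RintegralD. Qed.

Lemma meanZ r g : has_mean g -> mean (fun x => r * g x) = r * mean g.
Proof. by move=> ig; rewrite /mean RintegralZl. Qed.

Lemma has_mean_le g1 g2 : measurable_fun setT g1 ->
  (forall x, 0 <= g1 x <= g2 x) -> has_mean g2 -> has_mean g1.
Proof.
move=> mg1 g12; apply: le_integrable => //; first exact/measurable_EFinP.
move=> x _; have /andP[g10 g12'] := g12 x.
by rewrite /= lee_fin !ger0_norm ?(le_trans g10).
Qed.

Lemma le_mean g1 g2 : has_mean g1 -> has_mean g2 ->
  (forall x, g1 x <= g2 x) -> mean g1 <= mean g2.
Proof. by move=> i1 i2 g12; rewrite /mean le_Rintegral. Qed.

End RealIntegrals.

Section Stability.
Local Open Scope ring_scope.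
Context {d : measure_display} {X : measurableType d} {R : realType}.
Variables (mu : probability X R) (C : set X -> set (set X)) (T : set (set X)).
Hypothesis tree : is_tree_with mu C T.
Variables (f h L q b : R) (phi : X -> R).
Hypotheses (q01 : 0 < q < 1) (f0 : 0 < f) (fL : f <= L).
Hypotheses (h0 : 0 < h) (hf : h <= f `^ q) (b1 : 1 <= b).
Hypothesis Hb : Hq q b = ((1 - q) * L `^ q + q * L `^ (q - 1) * f) / h.
Hypotheses (phi0 : forall x, 0 <= phi x) (mphi : measurable_fun setT phi).
Hypotheses (iphi : (\int[mu]_x (phi x)%:E)%E = f%:E).
Hypotheses (iphiq : (\int[mu]_x (phi x `^ q)%:E)%E = h%:E).

Let q0 : 0 < q. Proof. by case/andP: q01. Qed.
Let q1 : q < 1. Proof. by case/andP: q01. Qed.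
Let L0 : 0 < L. Proof. exact: lt_le_trans fL. Qed.
Let A := (1 - q) * L `^ q + q * L `^ (q - 1) * f.

(** All the pointwise bounds of the first part are integrated against [mu] and
    combined with [kolmogorov_inequality].  The bound [I <= b^q h] is obtained
    from Young's inequality with the factor [z := (I / h)^(1/q)] in place of
    [b]: it turns the integral inequality into [Hq q z <= Hq q b], and the
    degenerate case [b = 1] needs no separate argument. *)
Lemma maximal_stability : exists I D : R,
  [/\ (\int[mu]_x (maxe (maximal mu T phi x) L%:E `^ q))%E = I%:E,
      (\int[mu]_x
        (`|maxe (maximal mu T phi x) L%:E - (b * phi x)%:E| `^ q))%E = D%:E,
      I <= b `^ q * h, b `^ q * h <= I + D &
      forall t, 0 < t -> D <= t `^ q * I +
        t `^ (q - 1) * (1 + t^-1) * ((b - 1) * (b `^ q * h - I))].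
Proof.
have [N [mN NL NE NA]] := kolmogorov_inequality tree q01 f0 fL phi0 mphi iphi.
have N0 x : 0 < N x by exact: lt_le_trans (NL x).
have b0 : 0 < b by exact: lt_le_trans b1.
have mpow (g : X -> R) r : measurable_fun setT g ->
    measurable_fun setT (fun x => g x `^ r).
  by move=> mg; exact: measurableT_comp (measurable_powR r) mg.
pose Nq x := N x `^ q; pose J x := phi x * N x `^ (q - 1).
pose P x := phi x `^ q; pose E x := `|N x - b * phi x| `^ q.
have mbphi : measurable_fun setT (fun x => b * phi x) by exact: measurable_funM.
have mNq : measurable_fun setT Nq by exact: mpow.
have mJ : measurable_fun setT J by apply: measurable_funM => //; exact: mpow.
have mE : measurable_fun setT E.
  apply: mpow; apply: measurableT_comp => //; exact: measurable_funB.
have iK : has_mean mu (kolmogorov_integrand q N phi).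
  apply: (ge0_has_mean _ _ NA).
    exact: measurable_kolmogorov_integrand.
  exact: (kolmogorov_integrand_ge0 q01 N phi0).
have J0 x : 0 <= J x by rewrite mulr_ge0 ?powR_ge0.
have Nq0 x : 0 <= Nq x by exact: powR_ge0.
have iNq : has_mean mu Nq.
  apply: (has_mean_le mNq _ (has_meanZ (1 - q)^-1 iK)) => x; rewrite Nq0/=.
  rewrite mulrC ler_pdivlMr ?subr_gt0// mulrC lerDl.
  by apply: mulr_ge0; [exact: ltW|exact: J0].
have iJ : has_mean mu J.
  apply: (has_mean_le mJ _ (has_meanZ q^-1 iK)) => x; rewrite J0/=.
  rewrite mulrC ler_pdivlMr// mulrC lerDr.
  by apply: mulr_ge0; [rewrite subr_ge0 ltW|exact: Nq0].
have iP : has_mean mu P.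
  apply: (@ge0_has_mean _ _ _ _ _ h) => [|x|]; last by rewrite iphiq.
    exact: mpow.
  exact: powR_ge0.
have PE : mean mu P = h by apply/EFin_inj; rewrite -meanE.
pose gap x := (q * b) * J x + ((1 - q) * Nq x + (- b `^ q) * P x).
have iG : has_mean mu gap.
  by apply: has_meanD; [|apply: has_meanD]; exact: has_meanZ.
have gapE x : young_gap q (N x) (b * phi x) = gap x.
  by rewrite /young_gap powRM ?(ltW b0)// /gap /J /Nq /P; ring.
have mean_gap : mean mu gap =
    q * b * mean mu J + (1 - q) * mean mu Nq - b `^ q * h.
  rewrite meanD ?meanD ?meanZ ?PE//; first by ring.
  - exact: has_meanZ.
  - exact: has_meanZ.
  - exact: has_meanZ.
  - by apply: has_meanD; exact: has_meanZ.
have bphi0 x : 0 <= b * phi x by rewrite mulr_ge0// ltW.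
have E0 x : 0 <= E x by exact: powR_ge0.
have Egap t x : 0 < t -> E x <= t `^ q * Nq x + 
    t `^ (q - 1) * (1 + t^-1) / (1 - q) * gap x.
  by move=> t0; rewrite -gapE; exact: dist_powR_le_gap.
have iEt t : has_mean mu (fun x => t `^ q * Nq x +
    t `^ (q - 1) * (1 + t^-1) / (1 - q) * gap x).
  by apply: has_meanD; exact: has_meanZ.
have iE : has_mean mu E.
  by apply: (has_mean_le mE _ (iEt 1)) => x; rewrite E0/= Egap.
exists (mean mu Nq), (mean mu E).
have mM := measurable_maximal tree fL phi0 mphi iphi.
have key : (1 - q) * mean mu Nq + q * mean mu J <= A.
  rewrite -lee_fin; apply: le_trans NA; rewrite meanE// lee_fin.
  rewrite -(meanZ (1 - q) iNq) -(meanZ q iJ) -meanD//; exact: has_meanZ.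
have young z : 0 < z -> z `^ q * h <= q * z * mean mu J + (1 - q) * mean mu Nq.
  move=> z0; rewrite -PE -(meanZ (z `^ q) iP) -(meanZ (q * z) iJ).
  rewrite -(meanZ (1 - q) iNq).
  rewrite -meanD; [|exact: has_meanZ|exact: has_meanZ].
  apply: le_mean; [exact: has_meanZ| |].
    by apply: has_meanD; exact: has_meanZ.
  move=> x; have zphi0 : 0 <= z * phi x by rewrite mulr_ge0// ltW.
  have := young_powR q01 zphi0 (N0 x).
  by rewrite powRM ?(ltW z0)// /J !mulrA.
set I := mean mu Nq in key young *.
have hI : h <= I.
  apply: (le_trans hf); apply: (@le_trans _ _ (L `^ q)).
    by apply: ge0_ler_powR; rewrite ?nnegrE ?(ltW q0) ?(ltW f0) ?(ltW L0).
  rewrite -lee_fin -meanE//.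
  apply: (@le_trans _ _ (\int[mu]_x (cst (L `^ q)%:E x)))%E.
    by rewrite integral_cstT.
  apply: ge0_le_integral => //.
  - by move=> x _; rewrite lee_fin powR_ge0.
  - exact/measurable_EFinP.
  - move=> x _; rewrite lee_fin.
    by apply: ge0_ler_powR; rewrite ?nnegrE ?(ltW q0) ?(ltW L0) ?(ltW (N0 x)).
have I0 : 0 < I by exact: lt_le_trans hI.
have IH : I <= b `^ q * h.
  pose z := (I / h) `^ q^-1.
  have Ih1 : 1 <= I / h by rewrite ler_pdivlMr// mul1r.
  have z1 : 1 <= z.
    rewrite [leLHS](_ : 1 = 1 `^ q^-1); last by rewrite powR1.
    apply: ge0_ler_powR; rewrite ?nnegrE ?invr_ge0 ?(ltW q0)//.
    exact: le_trans Ih1.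
  have z0 : 0 < z by exact: lt_le_trans z1.
  have zq : z `^ q = I / h.
    by rewrite /z -powRrM mulVf ?gt_eqF// powRr1// (le_trans _ Ih1).
  have zb : z <= b.
    apply: (Hq_le q01) => //; rewrite Hb HqE// zq ler_pdivlMr//.
    have -> : I / h * (1 - q + q / z) * h = (1 - q) * I + q * (I / z).
      by field; rewrite !lt0r_neq0.
    apply: le_trans key; rewrite lerD2l ler_pM2l// ler_pdivrMr//.
    have := young z z0; rewrite zq divfK ?lt0r_neq0//.
    move=> hz; rewrite -(ler_pM2l q0); lra.
  rewrite -ler_pdivrMr// -zq; apply: ge0_ler_powR; rewrite ?nnegrE ?(ltW q0)//.
  - exact: ltW.
  - exact: ltW.
split => //.
- rewrite -meanE//; apply: ge0_ae_eq_integral => //.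
  + exact: measurableT_comp (@measurable_poweR R q) mM.
  + exact/measurable_EFinP.
  + by move=> x _; exact: poweR_ge0.
  + by move=> x _; rewrite lee_fin Nq0.
  + by rewrite /ae_eq; apply: filterS NE => x -> _.
- rewrite -meanE//; apply: ge0_ae_eq_integral => //.
  + have mD : measurable_fun setT
        (fun x => maxe (maximal mu T phi x) L%:E - (b * phi x)%:E)%E.
      by apply: emeasurable_funB => //; exact/measurable_EFinP.
    exact: measurableT_comp (@measurable_poweR R q)
      (measurableT_comp (@abse_measurable _ _) mD).
  + exact/measurable_EFinP.
  + by move=> x _; exact: poweR_ge0.
  + by move=> x _; rewrite lee_fin E0.
  + by rewrite /ae_eq; apply: filterS NE => x -> _.
- rewrite -PE -(meanZ (b `^ q) iP) -meanD//; apply: le_mean.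
  + exact: has_meanZ.
  + exact: has_meanD.
  + move=> x; rewrite -powRM ?(ltW b0)//.
    by apply: powR_subadd => //; exact: ltW.
- move=> t t0.
  apply: (@le_trans _ _ (t `^ q * I + t `^ (q - 1) * (1 + t^-1) / (1 - q) *
    (q * b * mean mu J + (1 - q) * I - b `^ q * h))).
    rewrite -mean_gap -(meanZ _ iNq) -(meanZ _ iG) -meanD;
      [|exact: has_meanZ..].
    by apply: le_mean => // x; exact: Egap.
  rewrite lerD2l -!mulrA ler_pM2l ?powR_gt0//.
  rewrite ler_pM2l ?addr_gt0 ?invr_gt0// ler_pdivrMl ?subr_gt0//.
  have AE : A = h * Hq q b by rewrite Hb mulrC divfK ?lt0r_neq0.
  have := ler_wpM2l (ltW b0) key; rewrite AE HqE//.
  have -> : b * (h * (b `^ q * (1 - q + q / b))) =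
    h * b `^ q * ((1 - q) * b + q) by field; exact: lt0r_neq0.
  by move=> hh; lra.
Qed.

End Stability.

(** * Geometric layers of cubes *)

Section GeometricLayers.
Context {d : measure_display} {X : measurableType d} {R : realType}.
Variable mu : probability X R.

Lemma last_member (V : (set X)^nat) x : V 0%N x -> ~ (forall n, V n x) ->
  exists n, V n x /\ ~ V n.+1 x.
Proof.
move=> V0 nV; have ex : exists n, `[< ~ V n x >].
  apply: contrapT => all; apply: nV => n; apply: contrapT => nVn.
  by apply: all; exists n; exact/asboolP.
case: (ex_minnP ex) => -[|n] /asboolP nVn minn; first by [].
exists n; split => //; apply: contrapT => nVn'.
by have := minn n (introT (asboolP _) nVn'); rewrite ltnn.
Qed.

(** The layers [V n] minus [V n.+1] fill [V 0] up to the intersection of the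
    [V n], which is null, and their contributions form a geometric series. *)
Lemma geometric_layers_integral (V : (set X)^nat) (g : X -> R) (a rho w z : R) :
  (forall n, measurable (V n)) -> (forall n, V n.+1 `<=` V n) ->
  (forall n, mu (V n) = (a * rho ^+ n)%:E) ->
  (0 <= rho < 1)%R -> (0 <= z)%R -> (rho * z < 1)%R ->
  measurable_fun setT g -> (forall x, 0 <= g x)%R ->
  (forall n x, V n x -> ~ V n.+1 x -> g x = w * z ^+ n)%R ->
  \int[mu]_(x in V 0%N) (g x)%:E = (w * (1 - rho) * a / (1 - rho * z))%:E.
Proof.
move=> mV VS muV /andP[rho0 rho1] z0 rz1 mg g0 gV.
have ndV : nonincreasing_seq V.
  by apply/nonincreasing_seqP => n; apply/subsetPset.
have Vle m n : (m <= n)%N -> V n `<=` V m by move=> mn; apply/subsetPset/ndV.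
have muVy n : mu (V n) < +oo by rewrite muV ltry.
pose D n := V n `\` V n.+1.
have mD n : measurable (D n) by exact: measurableD.
have muD n : mu (D n) = (a * (1 - rho) * rho ^+ n)%:E.
  have -> : mu (D n) = mu (V n) - mu (V n `&` V n.+1).
    by apply: measureD => //; exact: muVy.
  rewrite (setIidr (VS n)) !muV -EFinB; congr EFin.
  by rewrite exprS; ring.
have tD : trivIset setT D.
  apply/trivIsetP => m n _ _ mn; apply/seteqP; split => // x [[Vm Vm'] [Vn Vn']].
  move: mn; rewrite neq_ltn => /orP[mn|nm].
    by apply: Vm'; exact: (Vle _ _ mn).
  by apply: Vn'; exact: (Vle _ _ nm).
pose Z := \bigcap_n V n.
have mZ : measurable Z by exact: bigcapT_measurable.
have muZ : mu Z = 0.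
  have cV := @nonincreasing_cvg_mu _ _ _ mu _ (muVy 0%N) mV mZ ndV.
  rewrite -(cvg_lim _ cV)//; apply/cvg_lim => //.
  rewrite (_ : mu \o V = EFin \o geometric a rho); last first.
    by apply/funext => n /=; rewrite muV.
  apply: cvg_EFin; first exact: nearW.
  by apply: cvg_geometric; rewrite ger0_norm.
have V0D : V 0%N `\` Z = \bigcup_n D n.
  apply/seteqP; split => x; last first.
    move=> [n _ [Vn Vn']]; split; first exact: (Vle 0%N n).
    by move=> Zx; apply: Vn'; exact: Zx.
  move=> [V0x nZ]; have [|n Dn] := last_member V0x; last by exists n.
  by move=> Vx; apply: nZ => n _; exact: Vx.
have mgE : measurable_fun setT (EFin \o g) by exact/measurable_EFinP.
rewrite (ge0_negligible_integral mZ)//; last 2 first.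
- exact: measurable_funS mgE.
- by move=> x _; rewrite lee_fin.
rewrite V0D ge0_integral_bigcup//; last 2 first.
- by apply: measurable_funS mgE => //; exact: bigcupT_measurable.
- by move=> x _; rewrite lee_fin.
have gD n : \int[mu]_(x in D n) (g x)%:E =
    (geometric (w * (1 - rho) * a) (rho * z) n)%:E.
  rewrite (@eq_integral _ _ _ mu (D n) (fun=> (w * z ^+ n)%:E)); last first.
    by move=> x /[!inE] -[Vn Vn']; rewrite (gV n).
  rewrite integral_cst// [X in _ * X](_ : _ = (a * (1 - rho) * rho ^+ n)%:E).
    by rewrite -EFinM /= exprMn; congr EFin; ring.
  exact: muD.
rewrite (eq_eseriesr (fun n _ => gD n)).
apply/cvg_lim => //.
rewrite (_ : (fun n => _) =
    EFin \o series (geometric (w * (1 - rho) * a) (rho * z))).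
  apply: cvg_EFin; first exact: nearW.
  by apply: cvg_geometric_series; rewrite ger0_norm// mulr_ge0.
by apply/funext => n /=; rewrite sumEFin.
Qed.

End GeometricLayers.

Section NestedFamilies.
Context {d : measure_display} {X : measurableType d} {R : realType}.
Variables (mu : probability X R) (C : set X -> set (set X)) (T : set (set X)).
Hypothesis tree : is_tree_with mu C T.

(** Each cube [I] of generation [k] is given, once and for all, a disjoint
    family of cubes of total mass [rho] times that of [I]; generation [k + 1]
    gathers these families.  The proportion [rho] is thus inherited by every
    cube, which makes the construction self-similar. *)
Lemma nested_families (theta rho : R) :
  (0 <= theta <= 1)%R -> (0 <= rho <= 1)%R ->
  exists F : nat -> set (set X), let U k := \bigcup_(I in F k) I in
  [/\ forall k, F k `<=` T, forall k, U k.+1 `<=` U k,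
      forall j, mu (U j) = (rho ^+ j * theta)%:E &
      forall k j I, F k I -> mu (I `&` U (k + j)%N) = (rho ^+ j)%:E * mu I].
Proof.
move=> /andP[theta0 theta1] /andP[rho0 rho1].
have mufin I : T I -> mu I \is a fin_num.
  by move=> TI; apply: fin_num_measure; exact: tree_measurable tree _ TI.
have exS I : exists S : set (set X), T I -> [/\ S `<=` T, trivIset S id,
    forall J, S J -> J `<=` I & mu (\bigcup_(J in S) J) = rho%:E * mu I].
  have [TI|nTI] := pselect (T I); last by exists set0.
  have m0 : (0 <= fine (mu I))%R by exact: fine_ge0.
  have [||S [ST tS SI muS]] := tree_family_of_mass tree (a := rho * fine (mu I)) TI.
  - exact: mulr_ge0.
  - by rewrite -[leRHS](fineK (mufin _ TI)) lee_fin ler_piMl.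
  by exists S => _; split => //; rewrite muS EFinM fineK// mufin.
have [S SP] := choice exS.
have [||F0 [F0T tF0 _ muF0]] :=
  tree_family_of_mass tree (a := theta) (tree_root tree).
- by [].
- by rewrite probability_setT lee_fin.
pose F := fix F k := if k is k'.+1 then \bigcup_(I in F k') S I else F0.
exists F => U.
have FT k : F k `<=` T.
  elim: k => [//|k IH] J [I FI]; have [ST _ _ _] := SP I (IH _ FI); exact: ST.
have cF k : countable (F k) := tree_subfamily_countable tree (FT k).
have mF k I : F k I -> measurable I.
  by move=> /FT TI; exact: (tree_measurable tree TI).
have tF k : trivIset (F k) id.
  elim: k => [//|k IH] J J' [I FI SJ] [I' FI' SJ'] [x [Jx J'x]].
  have [ST tS SI _] := SP I (FT _ _ FI); have [_ _ SI' _] := SP I' (FT _ _ FI').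
  have II' : I = I'.
    by apply: IH => //; exists x; split; [exact: (SI J)|exact: (SI' J')].
  by rewrite -II' in SJ'; apply: tS => //; exists x.
have US k : U k.+1 `<=` U k.
  move=> x [J [I FI SJ] Jx]; exists I => //.
  by have [_ _ SI _] := SP I (FT _ _ FI); exact: (SI J).
have Uadd k j : U (k + j)%N `<=` U k.
  elim: j => [|j IH]; first by rewrite addn0.
  by rewrite addnS; apply: subset_trans IH; exact: US.
have mU k : measurable (U k) by exact: countable_bigcup_measurable (cF k) (mF k).
have FU k I : F k I -> I `&` U k.+1 = \bigcup_(J in S I) J.
  move=> FI; have [_ _ SI _] := SP I (FT _ _ FI); apply/seteqP; split => x.
    move=> [Ix [J [I' FI' SJ] Jx]]; exists J => //.
    have [_ _ SI' _] := SP I' (FT _ _ FI').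
    by rewrite (tF k I I')//; exists x; split => //; exact: (SI' J).
  by move=> [J SJ Jx]; split; [exact: (SI J)|exists J => //; exists I].
have main j k I : F k I -> mu (I `&` U (k + j)%N) = (rho ^+ j)%:E * mu I.
  elim: j k I => [|j IH] k I FI.
    rewrite addn0 expr0 mul1e (setIidl _)// => x Ix; by exists I.
  have [ST tS SI muS] := SP I (FT _ _ FI).
  rewrite -addSnnS -(setIidr (Uadd k.+1 j)) setIA FU//.
  have -> : mu (\bigcup_(J in S I) J `&` U (k.+1 + j)%N) =
      (rho ^+ j)%:E * mu (\bigcup_(J in S I) J `&` setT).
    apply: measure_bigcup_proportional => //.
    - exact: tree_subfamily_countable tree _ ST.
    - by move=> J /ST TJ; exact: (tree_measurable tree TJ).
    - move=> J SJ; rewrite setIT; apply: IH; by exists I.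
  by rewrite setIT muS muleA -EFinM exprSr.
split; [exact: FT|exact: US| |by move=> k j; exact: main] => j.
have -> : mu (U j) = mu (U 0%N `&` U j).
  by rewrite (setIidr (Uadd 0%N j)).
have -> : mu (U 0%N `&` U j) = (rho ^+ j)%:E * mu (U 0%N `&` setT).
  apply: measure_bigcup_proportional => //.
  - exact: (mF 0%N).
  - by move=> I FI; rewrite setIT; have := main j 0%N I FI; rewrite add0n.
by rewrite setIT muF0 -EFinM.
Qed.

(** [idx x] is the last generation containing [x].  It is 0 off the first
    generation, where the function [w * z ^+ idx x] must be equal to [w], and
    on the null set of the points that lie in all generations. *)
Lemma layer_index (theta rho : R) : (0 <= theta <= 1)%R -> (0 < rho < 1)%R ->
  exists idx : X -> nat,
    (forall w z : R, (0 <= w)%R -> (0 <= z)%R -> (rho * z < 1)%R ->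
      measurable_fun setT (fun x => w * z ^+ idx x)%R /\
      \int[mu]_x (w * z ^+ idx x)%:E =
        (w * (1 - theta + theta * (1 - rho) / (1 - rho * z)))%:E) /\
    (forall x, (0 < idx x)%N -> exists I, [/\ T I, I x &
      forall w z : R, (0 <= w)%R -> (0 <= z)%R -> (rho * z < 1)%R ->
      \int[mu]_(x in I) (w * z ^+ idx x)%:E =
        (w * z ^+ idx x * (1 - rho) / (1 - rho * z))%:E * mu I]).
Proof.
move=> theta01 /andP[rho0 rho1].
have [|F] := @nested_families theta rho theta01; first by rewrite !ltW.
set U := fun k => \bigcup_(I in F k) I => -[FT US muU muIU].
have mU k : measurable (U k).
  apply: countable_bigcup_measurable.
    exact: tree_subfamily_countable tree _ (FT k).
  by move=> I /FT TI; exact: (tree_measurable tree TI).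
have ndU : nonincreasing_seq U.
  by apply/nonincreasing_seqP => n; apply/subsetPset.
have Ule m n : (m <= n)%N -> U n `<=` U m by move=> mn; apply/subsetPset/ndU.
pose P x := [set k | U k x /\ ~ U k.+1 x].
pose idx x := xget 0%N (P x).
have idxE k x : U k x -> ~ U k.+1 x -> idx x = k.
  move=> Uk Uk'; rewrite /idx; case: xgetP => [m _ [Um Um']|/(_ k)[]//].
  apply/eqP; rewrite eqn_leq; apply/andP; split; rewrite leqNgt; apply/negP => lt.
    by apply: Uk'; exact: (Ule _ _ lt).
  by apply: Um'; exact: (Ule _ _ lt).
have idx0 x : ~ U 0%N x -> idx x = 0%N.
  move=> nU; rewrite /idx; case: xgetP => [m _ [Um _]|//].
  by exfalso; apply: nU; exact: (Ule 0%N m).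
have idxU x : (0 < idx x)%N -> U (idx x) x.
  by rewrite /idx; case: xgetP => [m _ []|].
have idxT x : (forall k, U k x) -> idx x = 0%N.
  by move=> Ux; rewrite /idx; case: xgetP => [m _ [_ []]|].
have midx (w z : R) : measurable_fun setT (fun x => w * z ^+ idx x)%R.
  (* pieces on which [idx] is constant: outside, the null core, the layers *)
pose G n := match n with 0 => ~` U 0%N | 1 => \bigcap_k U k
    | k.+2 => U k `\` U k.+1 end.
  apply: (@measurable_fun_pieces _ _ _ _ (range G)).
  - by apply: sub_countable (countableP [set: nat]); exact: card_image_le.
  - move=> _ [[|[|k]] _ <-] /=; first exact: measurableC.
      exact: bigcapT_measurable.
    exact: measurableD.
  - move=> x; have [U0|nU0] := pselect (U 0%N x); last first.
      by exists (G 0%N) => //; exists 0%N.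
    have [Ua|nUa] := pselect (forall k, U k x).
      by exists (G 1%N); [exists 1%N|move=> k _; exact: Ua].
    have [n Dn] := last_member U0 nUa.
    by exists (G n.+2); [exists n.+2|].
  - move=> _ x y [[|[|k]] _ <-] /=.
    + by move=> /idx0 -> /idx0 ->.
    + by move=> Ux Uy; rewrite !idxT// => k; [exact: Uy|exact: Ux].
    + by move=> [/idxE H /H ->] [/idxE H' /H' ->].
exists idx; split.
- move=> w z w0 z0 rz1; split => //.
  have g0 x : (0 <= w * z ^+ idx x)%R by rewrite mulr_ge0// exprn_ge0.
  have mgE : measurable_fun setT (fun x => (w * z ^+ idx x)%:E).
    by apply/measurable_EFinP.
  have mC : measurable (~` U 0%N) by exact: measurableC.
  rewrite -(setvU (U 0%N)) ge0_integral_setU//; last 3 first.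
  + by rewrite setvU.
  + by move=> x _; rewrite lee_fin.
  + by apply/disj_setPS => x [].
  rewrite (@geometric_layers_integral _ _ _ _ U (fun x => w * z ^+ idx x)%R
    theta rho w z)//.
  + rewrite (@eq_integral _ _ _ mu _ (fun=> w%:E)); last first.
      by move=> x /[!inE] /idx0 ->; rewrite expr0 mulr1.
    rewrite integral_cst// [X in _ * X](_ : _ = (1 - theta)%:E); last first.
      by rewrite EFinB -[theta]mul1r -(expr0 rho) -muU; exact: probability_setC.
    by rewrite -EFinM -EFinD; congr EFin; ring.
  + by move=> n; rewrite muU mulrC.
  + by rewrite ltW.
  + by move=> n x Un Un'; rewrite (idxE n).
- move=> x idxgt0; have [I FI Ix] := idxU x idxgt0.
  have TI := FT _ _ FI; have mI := tree_measurable tree TI.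
  exists I; split => // w z w0 z0 rz1.
  have muIfin : mu I \is a fin_num by exact: fin_num_measure.
  have IU : I `&` U (idx x) = I.
    by apply: setIidl => y Iy; exists I.
  have := @geometric_layers_integral _ _ _ mu (fun n => I `&` U (idx x + n)%N)
    (fun y => w * z ^+ idx y)%R (fine (mu I)) rho (w * z ^+ idx x) z.
  rewrite addn0 IU => ->//.
  + by rewrite -[in RHS](fineK muIfin) -EFinM; congr EFin; ring.
  + by move=> n; exact: measurableI.
  + by move=> n; apply: setIS; rewrite addnS; exact: US.
  + by move=> n; rewrite muIU// -{1}(fineK muIfin) -EFinM mulrC.
  + by rewrite ltW.
  + by move=> y; rewrite mulr_ge0// exprn_ge0.
  + move=> n y [Iy Un] nU; rewrite (idxE (idx x + n)%N)// ?exprD ?mulrA//.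
    by move=> Un'; apply: nU; split => //; rewrite addnS.
Qed.

End NestedFamilies.

(** * The value of the Bellman function and the theorem *)

Section BellmanValue.
Context {d : measure_display} {X : measurableType d} {R : realType}.
Variables (mu : probability X R) (C : set X -> set (set X)) (T : set (set X)).
Hypothesis tree : is_tree_with mu C T.
Variables (f h L q : R).
Hypotheses (q01 : (0 < q < 1)%R) (f0 : (0 < f)%R) (fL : (f <= L)%R).
Hypotheses (h0 : (0 < h)%R) (hf : (h <= f `^ q)%R).

Let q0 : (0 < q)%R. Proof. by case/andP: q01. Qed.
Let q1 : (q < 1)%R. Proof. by case/andP: q01. Qed.
Let L0 : (0 < L)%R. Proof. exact: lt_le_trans fL. Qed.
Let A := ((1 - q) * L `^ q + q * L `^ (q - 1) * f)%R.

Lemma bellman_ge_scaled (b : R) (psi : X -> R) : (0 < b)%R ->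
  (forall x, 0 <= psi x)%R -> measurable_fun setT psi ->
  \int[mu]_x (psi x)%:E = f%:E -> \int[mu]_x (psi x `^ q)%:E = h%:E ->
  (forall x, (b * psi x)%:E <= maxe (maximal mu T psi x) L%:E) ->
  (b `^ q * h)%:E <= bellman mu T q f h L.
Proof.
move=> b0 psi0 mpsi ipsi ipsiq bM.
apply: (@le_trans _ _
  (\int[mu]_x (maxe (maximal mu T psi x) L%:E `^ q))); last first.
  by apply: ereal_sup_ubound; exists psi.
have mq : measurable_fun setT (fun x => (psi x `^ q)%:E).
  by apply/measurable_EFinP; exact: measurableT_comp (measurable_powR q) mpsi.
rewrite EFinM -ipsiq -ge0_integralZl_EFin//; last 2 first.
- by move=> x _; rewrite lee_fin powR_ge0.
- exact: powR_ge0.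
apply: ge0_le_integral => //.
- by move=> x _; rewrite -EFinM lee_fin mulr_ge0// powR_ge0.
- exact: measurable_funeM.
- exact: measurableT_comp (@measurable_poweR R q)
    (measurable_maximal tree fL psi0 mpsi ipsi).
- move=> x _; rewrite -EFinM -powRM ?(ltW b0)// -poweR_EFin.
  have bpsi0 : 0 <= (b * psi x)%:E by rewrite lee_fin mulr_ge0// ltW.
  apply: gt0_ler_poweR; rewrite ?(ltW q0) ?in_itv/= ?bpsi0 ?leey//.
  by rewrite andbT; exact: le_trans (bM x).
Qed.

(** The function is [L / b] times the power of exponent [idx x] of the layer
    ratio.  Where [idx x] is 0, [b] times its value is [L]; elsewhere [b] times
    its value is its average over a cube of generation [idx x] containing
    [x]. *)
Lemma extremal_function (b dl : R) : (1 < b)%R -> (L / f < b)%R ->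
  (0 < dl < 1)%R -> profile_power q f L dl b = h ->
  (b `^ q * h)%:E <= bellman mu T q f h L.
Proof.
move=> b1 Lb dl01 hE; have /andP[dl0 dl1] := dl01.
have b0 : (0 < b)%R by exact: lt_trans b1.
have /andP[th0 th1] := stopped_mass_itv f0 fL b1 Lb.
set theta := stopped_mass f L b in th0 th1.
have rho01 : (0 < 1 - dl < 1)%R by rewrite subr_gt0 dl1 gtrBl.
have theta01 : (0 <= theta <= 1)%R by rewrite ltW.
have [idx [idxX idxI]] := layer_index tree theta01 rho01.
set rho := (1 - dl)%R in rho01 idxX idxI.
pose r := layer_ratio dl b; pose v := (L / b)%R.
have r0 : (0 < r)%R by exact: layer_ratio_gt0.
have v0 : (0 < v)%R by rewrite divr_gt0.
have rho0 : (0 < rho)%R by case/andP: rho01.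
have rr : (rho * r = 1 - dl / b)%R.
  by rewrite /r /layer_ratio -/rho mulrC divfK ?lt0r_neq0.
have rr1 : (rho * r < 1)%R by rewrite rr gtrBl divr_gt0.
have rq1 : (rho * r `^ q < 1)%R by exact: layer_decay_lt1.
have [mpsi ipsi] := idxX v r (ltW v0) (ltW r0) rr1.
have [mpsiq ipsiq] := idxX (v `^ q)%R (r `^ q)%R (powR_ge0 _ _) (powR_ge0 _ _) rq1.
have dlE : (1 - rho = dl)%R by rewrite /rho subKr.
have b10 : (b - 1 != 0)%R by rewrite lt0r_neq0// subr_gt0.
have intf : \int[mu]_x (v * r ^+ idx x)%:E = f%:E.
  rewrite ipsi rr dlE; congr EFin; rewrite /theta /stopped_mass /v.
  by field; rewrite subKr b10 !lt0r_neq0.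
have psi0 x : (0 <= v * r ^+ idx x)%R by rewrite mulr_ge0 ?exprn_ge0 ?ltW.
apply: (@bellman_ge_scaled b (fun x => v * r ^+ idx x)%R) => //.
- rewrite -hE /profile_power -/theta -/r -/v -/rho -[X in (theta * X)%R]dlE -ipsiq.
  apply: eq_integral => x _; congr EFin.
  by rewrite powRM ?(ltW v0) ?exprn_ge0 ?(ltW r0)// powR_exprn// ltW.
- move=> x; have [->|i0] := posnP (idx x).
    by rewrite le_max expr0 mulr1 /v mulrC divfK ?lt0r_neq0// lexx orbT.
  have [I [TI Ix iI]] := idxI x i0.
  have [AvI _ cI] := integral_cube tree psi0 mpsi intf TI.
  apply: (@le_trans _ _ (cube_avg mu (fun x => v * r ^+ idx x)%R I)%:E); last first.
    rewrite le_max; apply/orP; left; rewrite /maximal; apply: ereal_sup_ubound.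
    by exists I => //; rewrite -AvI; under eq_fun do rewrite ger0_norm//.
  have e := etrans (esym cI) (iI v r (ltW v0) (ltW r0) rr1).
  have muIfin : mu I \is a fin_num.
    by apply: fin_num_measure; exact: (tree_measurable tree TI).
  have muI : (0 < fine (mu I))%R.
    by rewrite fine_gt0// (tree_pos tree TI)/= ltey_eq muIfin.
  rewrite -(fineK muIfin) -!EFinM in e.
  rewrite lee_fin (mulIf (lt0r_neq0 muI) (EFin_inj e)) rr dlE.
  rewrite le_eqVlt; apply/orP; left; apply/eqP.
  by field; rewrite subKr !lt0r_neq0.
Qed.

Lemma bellman_le (b : R) : (1 <= b)%R -> Hq q b = (A / h)%R ->
  bellman mu T q f h L <= (b `^ q * h)%:E.
Proof.
move=> b1 Hb; apply: ge_ereal_sup => _ [psi [psi0 mpsi ipsi ipsiq] <-].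
have [I [D [-> _ Ile _ _]]] :=
  maximal_stability tree q01 f0 fL h0 hf b1 Hb psi0 mpsi ipsi ipsiq.
by rewrite lee_fin.
Qed.

Lemma Hq_ratio : Hq q (L / f) = (A / f `^ q)%R.
Proof.
rewrite HqE ?divr_gt0// (powR_div _ (ltW L0) f0) /A powR_subr1//; field.
by rewrite !lt0r_neq0// powR_gt0.
Qed.

(** Either [b = L / f], which forces [h = f^q], and the constant [f] is
    extremal; or [L / f < b], and for every parameter strictly in between
    [profile_power_tuning] and [extremal_function] give the bound with a
    parameter at least as large. *)
Lemma bellman_ge (b : R) : (1 <= b)%R -> Hq q b = (A / h)%R ->
  (b `^ q * h)%:E <= bellman mu T q f h L.
Proof.
move=> b1 Hb; have b0 : (0 < b)%R by exact: lt_le_trans b1.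
have fq : (0 < f `^ q)%R by rewrite powR_gt0.
have A0 : (0 < A)%R.
  by rewrite addr_gt0// !mulr_gt0 ?subr_gt0 ?powR_gt0.
have Lf1 : (1 <= L / f)%R by rewrite ler_pdivlMr// mul1r.
have Lfb : (L / f <= b)%R.
  by apply: (Hq_le q01) => //; rewrite Hq_ratio Hb ler_pM2l// lef_pV2.
move: Lfb; rewrite le_eqVlt => /predU1P[Lfb|Lfb].
  have hE : h = (f `^ q)%R.
    move: Hb; rewrite -Lfb Hq_ratio => /(mulfI (lt0r_neq0 A0)).
    by move=> /invr_inj ->.
  apply: (@bellman_ge_scaled b (fun=> f)) => //.
  - by move=> x; exact: ltW.
  - by rewrite integral_cstT.
  - by rewrite hE integral_cstT.
  - by move=> x; rewrite -Lfb divfK ?lt0r_neq0// le_max lexx orbT.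
rewrite leNgt; apply/negP => ltB.
(* [y] lies strictly between [y0] and [b^q], so the parameter [y^(1/q)] is
   admissible for [profile_power_tuning] and gives a bound above the Bellman
   value *)
pose y0 := Num.max (fine (bellman mu T q f h L) / h)%R ((L / f) `^ q)%R.
have y0b : (y0 < b `^ q)%R.
  rewrite gt_max; apply/andP; split; last first.
    by apply: gt0_ltr_powR; rewrite ?nnegrE ?(ltW b0) ?(le_trans ler01 Lf1).
  rewrite ltr_pdivrMr//; case: (bellman _ _ _ _ _ _) ltB => [s|//|_] /=.
    by rewrite lte_fin.
  by rewrite mulr_gt0 ?powR_gt0.
pose y := ((y0 + b `^ q) / 2)%R.
have y0y : (y0 < y)%R by rewrite midf_lt.
have yb : (y < b `^ q)%R by rewrite midf_lt.
have y0ge : (0 <= y0)%R by rewrite le_max powR_ge0 orbT.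
have yge : (0 <= y)%R by rewrite ltW// (le_lt_trans y0ge).
pose b' := (y `^ q^-1)%R.
have b'q : (b' `^ q = y)%R by rewrite /b' -powRrM mulVf ?gt_eqF// powRr1.
have rootK (x : R) : (0 <= x)%R -> ((x `^ q) `^ q^-1 = x)%R.
  by move=> x0; rewrite -powRrM divff ?gt_eqF// powRr1.
have Lb' : (L / f < b')%R.
  rewrite -[X in (X < _)%R](rootK _ (le_trans ler01 Lf1)).
  apply: gt0_ltr_powR; rewrite ?nnegrE ?invr_gt0 ?powR_ge0//.
  by apply: le_lt_trans y0y; rewrite le_max lexx orbT.
have b'b : (b' < b)%R.
  rewrite -[X in (_ < X)%R](rootK b (ltW b0)).
  by apply: gt0_ltr_powR; rewrite ?nnegrE ?invr_gt0 ?powR_ge0.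
have b'1 : (1 < b')%R by exact: le_lt_trans Lb'.
have [dl [b'' [dl01 b'b'' hE]]] :=
  profile_power_tuning q01 f0 fL h0 b'1 Lb' b'b Hb.
have := extremal_function (lt_le_trans b'1 b'b'') (lt_le_trans Lb' b'b'')
  dl01 hE.
have yb'' : (y <= b'' `^ q)%R.
  rewrite -b'q; apply: ge0_ler_powR; rewrite ?nnegrE ?(ltW q0) ?powR_ge0//.
  exact: le_trans (powR_ge0 _ _) b'b''.
have : (fine (bellman mu T q f h L) < b'' `^ q * h)%R.
  rewrite -ltr_pdivrMr//; apply: lt_le_trans yb''; apply: le_lt_trans y0y.
  by rewrite le_max lexx.
case: (bellman _ _ _ _ _ _) ltB => [s|//|//] _ /=.
by rewrite lee_fin => /lt_geF ->.
Qed.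

Lemma bellman_value (b : R) : (1 <= b)%R -> Hq q b = (A / h)%R ->
  bellman mu T q f h L = (b `^ q * h)%:E.
Proof.
by move=> b1 Hb; apply/eqP; rewrite eq_le bellman_le// bellman_ge.
Qed.

End BellmanValue.

Theorem theoremA (R : realType) (d : measure_display) (X : measurableType d)
    (mu : probability X R) (T : set (set X)) (q f h L : R)
    (phi : nat -> X -> R) :
  nonatomic mu ->
  is_tree mu T ->
  (0 < q < 1)%R ->
  (0 < f)%R ->
  (0 < h <= f `^ q)%R ->
  (f <= L)%R ->
  (forall n x, (0 <= phi n x)%R) ->
  (forall n, measurable_fun setT (phi n)) ->
  (forall n, good mu T (phi n)) ->
  (forall n, \int[mu]_x (phi n x)%:E = f%:E) ->
  (forall n, \int[mu]_x (phi n x `^ q)%:E = h%:E) ->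
  let c := omega q (((1 - q) * L `^ q + q * L `^ (q - 1) * f) / h)%R in
  \int[mu]_x (maxe (maximal mu T (phi n) x) L%:E `^ q) @[n --> \oo]
    --> bellman mu T q f h L
  <->
  \int[mu]_x (`|maxe (maximal mu T (phi n) x) L%:E
                - (c `^ q^-1 * phi n x)%:E| `^ q) @[n --> \oo] --> 0.
Proof.
move=> _ [C tree] q01 f0 /andP[h0 hf] fL phi0 mphi _ iphi iphiq c.
have /andP[q0 q1] := q01; have L0 : (0 < L)%R by exact: lt_le_trans fL.
have A1 : (1 <= ((1 - q) * L `^ q + q * L `^ (q - 1) * f) / h)%R.
  rewrite ler_pdivlMr// mul1r (le_trans hf)//.
  apply: (le_trans (young_powR q01 (ltW f0) L0)).
  by rewrite addrC -mulrA [(f * _)%R]mulrC.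
have [b b1 Hb] := Hq_surj q01 A1.
have b0 : (0 < b)%R by exact: lt_le_trans b1.
have -> : (c `^ q^-1 = b)%R.
  by rewrite /c -Hb omega_Hq// -powRrM divff ?gt_eqF// powRr1// ltW.
rewrite (bellman_value tree q01 f0 fL h0 hf b1 Hb).
set B := (b `^ q * h)%R; have B0 : (0 < B)%R by rewrite mulr_gt0 ?powR_gt0.
have stab n := maximal_stability tree q01 f0 fL h0 hf b1 Hb (phi0 n) (mphi n)
  (iphi n) (iphiq n).
have [I IP] := choice stab; have [D DP] := choice IP.
rewrite (_ : (fun n => _) = EFin \o I); last first.
  by apply/funext => n; have [-> _ _ _ _] := DP n.
rewrite (_ : (fun n => \int[mu]_x (`| _ | `^ q)) = EFin \o D); last first.
  by apply/funext => n; have [_ -> _ _ _] := DP n.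
have D0 n : (0 <= D n)%R.
  rewrite -lee_fin; have [_ <- _ _ _] := DP n.
  by apply: integral_ge0 => x _; exact: poweR_ge0.
have IB n : (I n <= B)%R by have [_ _ ? _ _] := DP n.
have BID n : (B <= I n + D n)%R by have [_ _ _ ? _] := DP n.
split=> [/fine_cvg cI|/fine_cvg cD]; (apply: cvg_EFin; first exact: nearW).
- have {}cI : I n @[n --> \oo] --> B by exact: cI.
  apply/cvgrPdist_le => e e0.
  (* [t] makes the part of the stability bound without deficit equal to half of
     [e] *)
  pose t := ((e / 2 / B) `^ q^-1)%R.
  have eB0 : (0 < e / 2 / B)%R by rewrite !divr_gt0.
  have t0 : (0 < t)%R by rewrite powR_gt0.
  have tq : (t `^ q * B = e / 2)%R.
    by rewrite /t -powRrM mulVf ?gt_eqF// powRr1 ?ltW// divfK ?gt_eqF.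
  pose K := (t `^ (q - 1) * (1 + t^-1) * (b - 1))%R.
  have K0 : (0 <= K)%R.
    by rewrite !mulr_ge0 ?powR_ge0 ?subr_ge0// addr_ge0// invr_ge0 ltW.
  have ceps : (K * (B - I n))%R @[n --> \oo] --> 0%R.
    rewrite -(mulr0 K) -(subrr B); apply: cvgMr; apply: cvgB => //; exact: cvg_cst.
  have e20 : (0 < e / 2)%R by rewrite divr_gt0.
  move/cvgrPdist_le : ceps => /(_ _ e20); apply: filterS => n.
  rewrite !sub0r !normrN => hn /=; rewrite ger0_norm//.
  have [_ _ _ _ /(_ t t0)] := DP n; rewrite -/B mulrA -/K => /le_trans; apply.
  rewrite [leRHS](splitr e); apply: lerD; last exact: le_trans (ler_norm _) hn.
  by rewrite -tq ler_pM2l ?powR_gt0.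
- have {}cD : D n @[n --> \oo] --> 0%R by exact: cD.
  apply: (@squeeze_cvgr _ _ _ _ (fun n => B - D n)%R (cst B)).
  + by apply: nearW => n /=; rewrite IB andbT lerBlDr.
  + by rewrite -[X in _ --> X]subr0; apply: cvgB => //; exact: cvg_cst.
  + exact: cvg_cst.
Qed.
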